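(* Let $R$ be one of the chain rings $\mathbb{G}_4=\mathbb{Z}_4[X]/(X^2+X+1)$, $\mathbb{S}_4=\mathbb{F}_4[X]/(X^2)$, $\mathbb{T}_4=\mathbb{F}_4[X;a\mapsto a^2]/(X^2)$. Then (i) $\mathrm{m}_6(R)\le 84$, and (ii) $\mathrm{m}_6(R)<84$ if $R\ne\mathbb{G}_4$.
   Context: $\mathbb{F}_4[X;a\mapsto a^2]$ denotes the skew polynomial ring with commutation rule $Xa=a^2X$. For a finite chain ring $R$ of length $2$ with residue field $\mathbb{F}_q$, the projective Hjelmslev plane $\mathrm{PHG}(2,R)$ is the incidence structure whose points are the free rank-$1$ submodules of the right module $R_R^3$, whose lines are the free rank-$2$ submodules of $R_R^3$, with incidence given by inclusion. A projective $(k,n)$-arc is a set of $k$ points meeting every line in at most $n$ points. For $0\le n\le q^2+q$, $\mathrm{m}_n(R)$ denotes the largest $k$ such that a projective $(k,n)$-arc exists in $\mathrm{PHG}(2,R)$. *)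

(* Defs.v *)
From HB Require Import structures.
From mathcomp Require Import all_boot all_order all_algebra.
From mathcomp Require Import ring.
Set Implicit Arguments. Unset Strict Implicit. Unset Printing Implicit Defensive.
Import GRing.Theory.
Local Open Scope ring_scope.

(* The field F_4 = {0, 1, w, w^2} with w^2 = w + 1.                          *)
Inductive F4 := F4_0 | F4_1 | F4_w | F4_w2.

Definition F4_code (x : F4) : 'I_4 :=
  match x with F4_0 => inord 0 | F4_1 => inord 1 | F4_w => inord 2 | F4_w2 => inord 3 end.
Definition F4_decode (i : 'I_4) : F4 :=
  match val i with 0%N => F4_0 | 1%N => F4_1 | 2%N => F4_w | _ => F4_w2 end.
Lemma F4_codeK : cancel F4_code F4_decode.
Proof. by case; rewrite /F4_decode /= inordK. Qed.

HB.instance Definition _ := Finite.copy F4 (can_type F4_codeK).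

(* addition: F4 as F_2-vector space with basis 1, w *)
Definition F4_add (x y : F4) : F4 :=
  match x, y with
  | F4_0, z | z, F4_0 => z
  | F4_1, F4_1 | F4_w, F4_w | F4_w2, F4_w2 => F4_0
  | F4_1, F4_w | F4_w, F4_1 => F4_w2
  | F4_1, F4_w2 | F4_w2, F4_1 => F4_w
  | F4_w, F4_w2 | F4_w2, F4_w => F4_1
  end.
Definition F4_opp (x : F4) : F4 := x.
Definition F4_mul (x y : F4) : F4 :=
  match x, y with
  | F4_0, _ | _, F4_0 => F4_0
  | F4_1, z | z, F4_1 => z
  | F4_w, F4_w => F4_w2
  | F4_w, F4_w2 | F4_w2, F4_w => F4_1
  | F4_w2, F4_w2 => F4_w
  end.

Lemma F4_addA : associative F4_add. Proof. by move=> [] [] []. Qed.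
Lemma F4_addC : commutative F4_add. Proof. by move=> [] []. Qed.
Lemma F4_add0 : left_id F4_0 F4_add. Proof. by case. Qed.
Lemma F4_addN : left_inverse F4_0 F4_opp F4_add. Proof. by case. Qed.
HB.instance Definition _ := GRing.isZmodule.Build F4 F4_addA F4_addC F4_add0 F4_addN.

Lemma F4_mulA : associative F4_mul. Proof. by move=> [] [] []. Qed.
Lemma F4_mulC : commutative F4_mul. Proof. by move=> [] []. Qed.
Lemma F4_mul1 : left_id F4_1 F4_mul. Proof. by case. Qed.
Lemma F4_mulDl : left_distributive F4_mul F4_add. Proof. by move=> [] [] []. Qed.
Lemma F4_one_neq0 : F4_1 != F4_0. Proof. by apply/eqP. Qed.
HB.instance Definition _ :=
  GRing.Zmodule_isComNzRing.Build F4 F4_mulA F4_mulC F4_mul1 F4_mulDl F4_one_neq0.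

Lemma F4_sqrD (a b : F4) : (a + b) ^+ 2 = a ^+ 2 + b ^+ 2.
Proof. by move: a b => [] []. Qed.

(* G_4 = Z_4[X]/(X^2+X+1): elements a + b*w, a b in Z_4, w^2 = -1 - w.      *)
Record G4 := MkG4 { g4a : 'Z_4; g4b : 'Z_4 }.
Definition G4_to (x : G4) : 'Z_4 * 'Z_4 := (g4a x, g4b x).
Definition G4_of (p : 'Z_4 * 'Z_4) : G4 := MkG4 p.1 p.2.
Lemma G4_toK : cancel G4_to G4_of. Proof. by case. Qed.
HB.instance Definition _ := Finite.copy G4 (can_type G4_toK).

Definition G4_add x y := MkG4 (g4a x + g4a y) (g4b x + g4b y).
Definition G4_opp x := MkG4 (- g4a x) (- g4b x).
Definition G4_zero := MkG4 0 0.
Definition G4_one := MkG4 1 0.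
(* (a + b w)(c + d w) = (ac - bd) + (ad + bc - bd) w *)
Definition G4_mul x y :=
  MkG4 (g4a x * g4a y - g4b x * g4b y)
       (g4a x * g4b y + g4b x * g4a y - g4b x * g4b y).

Lemma G4_addA : associative G4_add.
Proof. by move=> [? ?] [? ?] [? ?]; rewrite /G4_add /= !addrA. Qed.
Lemma G4_addC : commutative G4_add.
Proof. by move=> [a b] [c d]; rewrite /G4_add /= (addrC a) (addrC b). Qed.
Lemma G4_add0 : left_id G4_zero G4_add.
Proof. by move=> [? ?]; rewrite /G4_add /= !add0r. Qed.
Lemma G4_addN : left_inverse G4_zero G4_opp G4_add.
Proof. by move=> [? ?]; rewrite /G4_add /= !addNr. Qed.
HB.instance Definition _ := GRing.isZmodule.Build G4 G4_addA G4_addC G4_add0 G4_addN.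

Lemma G4_mulA : associative G4_mul.
Proof. move=> [a b] [c d] [e f]; rewrite /G4_mul /=; congr MkG4; ring. Qed.
Lemma G4_mulC : commutative G4_mul.
Proof. move=> [a b] [c d]; rewrite /G4_mul /=; congr MkG4; ring. Qed.
Lemma G4_mul1 : left_id G4_one G4_mul.
Proof. move=> [a b]; rewrite /G4_mul /=; congr MkG4; ring. Qed.
Lemma G4_mulDl : left_distributive G4_mul G4_add.
Proof. move=> [a b] [c d] [e f]; rewrite /G4_mul /G4_add /=; congr MkG4; ring. Qed.
Lemma G4_one_neq0 : G4_one != G4_zero. Proof. by apply/eqP. Qed.
HB.instance Definition _ :=
  GRing.Zmodule_isComNzRing.Build G4 G4_mulA G4_mulC G4_mul1 G4_mulDl G4_one_neq0.

(* S_4 = F_4[X]/(X^2): elements a + b X, (a + bX)(c + dX) = ac + (ad + bc)X. *)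
Record S4 := MkS4 { s4a : F4; s4b : F4 }.
Definition S4_to (x : S4) : F4 * F4 := (s4a x, s4b x).
Definition S4_of (p : F4 * F4) : S4 := MkS4 p.1 p.2.
Lemma S4_toK : cancel S4_to S4_of. Proof. by case. Qed.
HB.instance Definition _ := Finite.copy S4 (can_type S4_toK).

Definition S4_add x y := MkS4 (s4a x + s4a y) (s4b x + s4b y).
Definition S4_opp x := MkS4 (- s4a x) (- s4b x).
Definition S4_zero := MkS4 0 0.
Definition S4_one := MkS4 1 0.
Definition S4_mul x y :=
  MkS4 (s4a x * s4a y) (s4a x * s4b y + s4b x * s4a y).

Lemma S4_addA : associative S4_add.
Proof. by move=> [? ?] [? ?] [? ?]; rewrite /S4_add /= !addrA. Qed.
Lemma S4_addC : commutative S4_add.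
Proof. move=> [a b] [c d]; rewrite /S4_add /=; congr MkS4; ring. Qed.
Lemma S4_add0 : left_id S4_zero S4_add.
Proof. by move=> [? ?]; rewrite /S4_add /= !add0r. Qed.
Lemma S4_addN : left_inverse S4_zero S4_opp S4_add.
Proof. by move=> [? ?]; rewrite /S4_add /= !addNr. Qed.
HB.instance Definition _ := GRing.isZmodule.Build S4 S4_addA S4_addC S4_add0 S4_addN.

Lemma S4_mulA : associative S4_mul.
Proof. move=> [a b] [c d] [e f]; rewrite /S4_mul /=; congr MkS4; ring. Qed.
Lemma S4_mulC : commutative S4_mul.
Proof. move=> [a b] [c d]; rewrite /S4_mul /=; congr MkS4; ring. Qed.
Lemma S4_mul1 : left_id S4_one S4_mul.
Proof. move=> [a b]; rewrite /S4_mul /=; congr MkS4; ring. Qed.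
Lemma S4_mulDl : left_distributive S4_mul S4_add.
Proof. move=> [a b] [c d] [e f]; rewrite /S4_mul /S4_add /=; congr MkS4; ring. Qed.
Lemma S4_one_neq0 : S4_one != S4_zero. Proof. by apply/eqP. Qed.
HB.instance Definition _ :=
  GRing.Zmodule_isComNzRing.Build S4 S4_mulA S4_mulC S4_mul1 S4_mulDl S4_one_neq0.

(* T_4 = F_4[X; a |-> a^2]/(X^2), with X a = a^2 X: elements a + b X,        *)
(* (a + bX)(c + dX) = ac + (ad + b c^2) X.                                   *)
Record T4 := MkT4 { t4a : F4; t4b : F4 }.
Definition T4_to (x : T4) : F4 * F4 := (t4a x, t4b x).
Definition T4_of (p : F4 * F4) : T4 := MkT4 p.1 p.2.
Lemma T4_toK : cancel T4_to T4_of. Proof. by case. Qed.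
HB.instance Definition _ := Finite.copy T4 (can_type T4_toK).

Definition T4_add x y := MkT4 (t4a x + t4a y) (t4b x + t4b y).
Definition T4_opp x := MkT4 (- t4a x) (- t4b x).
Definition T4_zero := MkT4 0 0.
Definition T4_one := MkT4 1 0.
Definition T4_mul x y :=
  MkT4 (t4a x * t4a y) (t4a x * t4b y + t4b x * (t4a y) ^+ 2).

Lemma T4_addA : associative T4_add.
Proof. by move=> [? ?] [? ?] [? ?]; rewrite /T4_add /= !addrA. Qed.
Lemma T4_addC : commutative T4_add.
Proof. move=> [a b] [c d]; rewrite /T4_add /=; congr MkT4; ring. Qed.
Lemma T4_add0 : left_id T4_zero T4_add.
Proof. by move=> [? ?]; rewrite /T4_add /= !add0r. Qed.
Lemma T4_addN : left_inverse T4_zero T4_opp T4_add.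
Proof. by move=> [? ?]; rewrite /T4_add /= !addNr. Qed.
HB.instance Definition _ := GRing.isZmodule.Build T4 T4_addA T4_addC T4_add0 T4_addN.

Lemma T4_mulA : associative T4_mul.
Proof. move=> [a b] [c d] [e f]; rewrite /T4_mul /=; congr MkT4; ring. Qed.
Lemma T4_mul1 : left_id T4_one T4_mul.
Proof. move=> [a b]; rewrite /T4_mul /=; congr MkT4; ring. Qed.
Lemma T4_mulr1 : right_id T4_one T4_mul.
Proof. move=> [a b]; rewrite /T4_mul /=; congr MkT4; ring. Qed.
Lemma T4_mulDl : left_distributive T4_mul T4_add.
Proof. move=> [a b] [c d] [e f]; rewrite /T4_mul /T4_add /=; congr MkT4; ring. Qed.
Lemma T4_mulDr : right_distributive T4_mul T4_add.
Proof.
move=> [a b] [c d] [e f]; rewrite /T4_mul /T4_add /= F4_sqrD; congr MkT4; ring.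
Qed.
Lemma T4_one_neq0 : T4_one != T4_zero. Proof. by apply/eqP. Qed.
HB.instance Definition _ :=
  GRing.Zmodule_isNzRing.Build T4 T4_mulA T4_mul1 T4_mulr1 T4_mulDl T4_mulDr T4_one_neq0.

Lemma T4_noncomm : T4_mul (MkT4 0 1) (MkT4 F4_w 0) != T4_mul (MkT4 F4_w 0) (MkT4 0 1).
Proof. by apply/eqP; rewrite /T4_mul /=; case. Qed.

(* The projective Hjelmslev plane PHG(2,R) over a finite ring R, built on    *)
(* the RIGHT module R_R^3 (row vectors, scalars acting on the right).        *)
Section PHG.
Variable R : finNzRingType.

Definition vec := 'rV[R]_3.

Definition rscale (v : vec) (r : R) : vec := \row_i (v 0 i * r).

(* P is a free rank-1 submodule of R_R^3: P = xR with {x} a basis,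
   i.e. r |-> x r injective. *)
Definition is_point (P : {set vec}) : bool :=
  [exists x : vec, injectiveb (rscale x) && (P == [set rscale x r | r : R])].

(* L is a free rank-2 submodule of R_R^3: L = xR + yR with {x, y} a basis,
   i.e. (r, s) |-> x r + y s injective. *)
Definition is_line (L : {set vec}) : bool :=
  [exists x : vec, exists y : vec,
     injectiveb (fun rs : R * R => rscale x rs.1 + rscale y rs.2)
     && (L == [set rscale x rs.1 + rscale y rs.2 | rs : R * R])].

Definition is_arc (n : nat) (A : {set {set vec}}) : bool :=
  [forall P in A, is_point P] &&
  [forall L : {set vec}, is_line L ==> (#|[set P in A | P \subset L]| <= n)%N].

Definition m_arc (n : nat) : nat := \max_(A : {set {set vec}} | is_arc n A) #|A|.

End PHG.

(* Main.v *)
From HB Require Import structures.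
Require Import Defs.
From mathcomp Require Import all_boot all_order all_algebra.
From mathcomp Require Import zify ring.
Set Implicit Arguments. Unset Strict Implicit. Unset Printing Implicit Defensive.
Import GRing.Theory.

(* The points of the Hjelmslev plane fall into 21 neighbour classes, the points of PG(2, 4), and
   dually for the lines.  The 16 lines of a line class form an affine plane whose lines are the
   segments cut out on the five point classes of the line class: two segments in different point
   classes lie on a unique line.  Let a line class carry [N] points of an 84-arc, [n] of them in
   a given point class and [w] on a given segment there.  The four lines through the segment give
   [N + 4 w <= 24 + n], and the squares of the [w] for a point class, over all its segments in
   the five directions, sum to [n ^ 2 + 4 n].  Hence [n <= 6], and the segments of a direction
   carry 2, 2, 1, 0 or 2, 2, 2, 0 points when [n] is 5 or 6.

   The deficits [d], 6 minus the number of arc points on a line, of a line class satisfy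
   [sum d = 4 (24 - N)] and [sum d ^ 2 = (24 - N) ^ 2 + sum (4 sum w ^ 2 - n ^ 2)].  If they are
   all at most [b], then [sum d ^ 2 + (b - 1) k <= b sum d], where [k] counts the segments of a
   direction on which the sum of the deficits is not a multiple of [b].  When [N > 20] this
   leaves only the types 54444, 55533, 64444, 64443 and 66333 for the five values of [n].  In the
   other line classes the deficits bound the sum of [sum w ^ 2 - 4] over the point classes with
   [n = 4] by 12, plus 4 for each point class with [n <= 2]; but a point class with [n = 4] needs
   12 in all.  Counting the line classes with [N > 20] in both ways rules out [n > 4], so every
   point class has four points.  An 85-arc would contain an 84-arc having five points in a class.

   Now equality holds in the second moments, so every line meets an 84-arc in 2 or 6 points.
   The rings S_4 and T_4 contain F_4, hence their planes contain a subplane PG(2, 4) whose 21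
   lines cover every point once or five times: modulo 4 this would give 84 = 42. *)

(** * Finite sums *)

Lemma sum_eq_mul (T : finType) (a : T) (f : T -> nat) : \sum_i (i == a) * f i = f a.
Proof.
by rewrite (bigD1 a) //= eqxx mul1n big1 ?addn0 // => i /negbTE->.
Qed.

Lemma sum_cond_mul (I : finType) (P : pred I) (f : I -> nat) :
  \sum_(i | P i) f i = \sum_i P i * f i.
Proof. by rewrite big_mkcond; apply: eq_bigr => i _; case: (P i); rewrite ?mul1n. Qed.

Lemma eq_of_sum_eq (I : finType) (P : pred I) (f g : I -> nat) :
  (forall i, P i -> f i <= g i) -> \sum_(i | P i) f i = \sum_(i | P i) g i ->
  forall i, P i -> f i = g i.
Proof.
move=> fg sum_eq; have := leqif_sum (fun i Pi => leqif_eq (fg i Pi)).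
by rewrite sum_eq => -[_]; rewrite eqxx => /esym/forall_inP eq_fg i /eq_fg/eqP.
Qed.

Lemma odd_sum (I : finType) (P : pred I) (f : I -> nat) :
  odd (\sum_(i | P i) f i) = \big[addb/false]_(i | P i) odd (f i).
Proof. exact: (big_morph odd oddD). Qed.

Lemma sum_bool (T : finType) (A : pred T) : \sum_x A x = #|A|.
Proof. by rewrite -sum1_card [RHS]big_mkcond. Qed.

Lemma sumn_image (T : finType) (A : {pred T}) (f : T -> nat) :
  sumn [seq f x | x in A] = \sum_(x in A) f x.
Proof. by rewrite sumnE big_image. Qed.

Lemma count_image (T : finType) (A : {pred T}) (f : T -> nat) (P : pred nat) :
  count P [seq f x | x in A] = \sum_(x in A) P (f x).
Proof. by rewrite count_map -sum1_count big_enum_cond big_mkcondr. Qed.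

Section BoundedSums.
Variables (I : finType) (P : pred I) (b : nat) (h : I -> nat).
Hypothesis h_le : forall i, P i -> h i <= b.

Lemma sum_sqr_compl :
  \sum_(i | P i) h i ^ 2 + \sum_(i | P i) h i * (b - h i) = b * \sum_(i | P i) h i.
Proof.
rewrite -big_split big_distrr /=; apply: eq_bigr => i /h_le hb.
by rewrite -mulnn -mulnDr subnKC // mulnC.
Qed.

Lemma sum_sqr_le : \sum_(i | P i) h i ^ 2 <= b * \sum_(i | P i) h i.
Proof. by rewrite -sum_sqr_compl leq_addr. Qed.

Lemma sum_sqr_eq : \sum_(i | P i) h i ^ 2 = b * \sum_(i | P i) h i ->
  forall i, P i -> h i = 0 \/ h i = b.
Proof.
move/eqP; rewrite -sum_sqr_compl -[X in X == _]addn0 eqn_add2l eq_sym sum_nat_eq0.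
move=> /forall_inP E i Pi; have := E i Pi; have := h_le Pi.
by rewrite muln_eq0 subn_eq0; lia.
Qed.

Lemma sum_sqr_residue :
  \sum_(i | P i) h i ^ 2 + b.-1 * ~~ (b %| \sum_(i | P i) h i) <= b * \sum_(i | P i) h i.
Proof.
rewrite -sum_sqr_compl leq_add2l; case: (boolP (b %| _)) => [_|ndvd]; first by rewrite muln0.
have [i Pi ndvdi] : exists2 i, P i & ~~ (b %| h i).
  case: (pickP [pred i | P i & ~~ (b %| h i)]) => [i /andP[]|dvd_h]; first by exists i.
  by case/negP: ndvd; apply: dvdn_sum => i Pi; have := dvd_h i; rewrite /= Pi => /negPn.
rewrite (bigD1 i) //= muln1; apply: leq_trans (leq_addr _ _).
have h0 : h i != 0 by apply: contraNneq ndvdi => ->.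
have hb : h i != b by apply: contraNneq ndvdi => ->.
by have := h_le Pi; nia.
Qed.

End BoundedSums.

Lemma sum_sqr_apex (I : finType) (P : pred I) (h : I -> nat) (i : I) (b : nat) : P i ->
  (forall k, P k -> k != i -> h k <= b) ->
  \sum_(k | P k) h k ^ 2 + b * h i <= h i ^ 2 + b * \sum_(k | P k) h k.
Proof.
move=> Pi h_le; rewrite (bigD1 i) //= [X in _ <= _ + b * X](bigD1 i) //= mulnDr.
have /sum_sqr_le : forall k, P k && (k != i) -> h k <= b by move=> k /andP[]; apply: h_le.
by lia.
Qed.

Section Support.
Variables (T : finType) (f : T -> nat).

Definition support_size : nat := #|[pred s | 0 < f s]|.

Lemma sum_sqr_support : (forall s, f s <= 2) ->
  \sum_s f s ^ 2 + 2 * support_size = 3 * \sum_s f s.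
Proof.
move=> f_le; rewrite /support_size -sum_bool !big_distrr -big_split; apply: eq_bigr => s _ /=.
by case: (f s) (f_le s) => [|[|[]]].
Qed.

Lemma sum_le_support (b : nat) : (forall s, f s <= b) -> \sum_s f s <= b * support_size.
Proof.
move=> f_le; rewrite /support_size -sum_bool big_distrr; apply: leq_sum => s _ /=.
by case: (f s) (f_le s) => [|k]; rewrite ?muln0 ?muln1.
Qed.

Lemma support_le_sum (s : T) : f s + support_size <= \sum_t f t + 1.
Proof.
rewrite /support_size -sum_bool (bigD1 s) //= [X in _ <= X + 1](bigD1 s) //= -!addnA leq_add2l.
rewrite [X in _ <= X]addnC leq_add ?leq_b1 //; apply: leq_sum => t _.
by case: (f t).
Qed.

Lemma sum_sqr_le1 : (forall s, f s <= 1) -> \sum_s f s ^ 2 = \sum_s f s.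
Proof. by move=> f_le; apply: eq_bigr => s _; case: (f s) (f_le s) => [|[]]. Qed.

Lemma sum_le_sum_sqr : \sum_s f s <= \sum_s f s ^ 2.
Proof. by apply: leq_sum => s _; nia. Qed.

End Support.

Lemma sum_card_fibre_sqr (X S : finType) (B : {pred X}) (f : X -> S) :
  \sum_s #|[pred x in B | f x == s]| ^ 2 = \sum_(x in B) \sum_(y in B) (f x == f y).
Proof.
have fibre s : #|[pred x in B | f x == s]| = \sum_(x in B) (f x == s).
  by rewrite -sum1_card big_mkcondr.
under eq_bigr do rewrite fibre -mulnn big_distrlr /=.
rewrite exchange_big; apply: eq_bigr => x _; rewrite exchange_big; apply: eq_bigr => y _ /=.
rewrite -[RHS](sum_eq_mul (f x) (fun s => s == f y : nat)); apply: eq_bigr => s _.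
by rewrite ![_ == s]eq_sym.
Qed.

Lemma sum_card_fibre (X S : finType) (B : {pred X}) (f : X -> S) :
  \sum_s #|[pred x in B | f x == s]| = #|B|.
Proof.
rewrite -[RHS]sum1_card (partition_big f xpredT) //=.
by apply: eq_bigr => s _; rewrite -sum1_card.
Qed.

Lemma ex_subset_card (T : finType) (B A : {set T}) (k : nat) :
  B \subset A -> #|B| <= k <= #|A| ->
  exists C : {set T}, [/\ B \subset C, C \subset A & #|C| = k].
Proof.
move=> sBA; elim: k => [|k IHk] /andP[Bk kA].
  by exists B; split=> //; apply/eqP; rewrite -leqn0.
have [Bk'|Bk'] := leqP #|B| k; last by exists B; split=> //; apply/eqP; rewrite eqn_leq Bk.
have [|C [sBC sCA Ck]] := IHk; first by rewrite Bk' ltnW.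
have /subsetPn[x xA xC] : ~~ (A \subset C).
  by apply/negP => /subset_leq_card; rewrite Ck leqNgt kA.
exists (x |: C); split; first exact: subset_trans (subsetUr _ _).
  by rewrite subUset sub1set xA.
by rewrite cardsU1 xC Ck.
Qed.

(** * Weights on the affine plane *)

Section AffinePlane.
Variable F : finFieldType.
Implicit Types (j k : option F) (m : F * F) (s : F) (f g : F -> nat).

(* The label of the line through the point [m] of AG(2, F) in the parallel class [j]. *)
Definition parallel j m : F := (if j is Some t then m.2 + t * m.1 else m.1)%R.

Lemma parallel_pair_inj j k : j != k -> injective (fun m => (parallel j m, parallel k m)).
Proof.
case: j k => [t|] [u|] // jk [x y] [x' y'] [] /=.
- move=> Et Eu; suff Ex : x = x' by rewrite Ex in Et *; rewrite (addIr _ Et).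
  have /eqP : ((t - u) * (x - x') = 0)%R.
    have -> : ((t - u) * (x - x') = (y + t * x - (y' + t * x')) - (y + u * x - (y' + u * x')))%R.
      by ring.
    by rewrite Et Eu !subrr.
  have tu : t != u by apply: contraNneq jk => ->.
  by rewrite mulf_eq0 !subr_eq0 (negbTE tu) => /eqP.
- by move=> + Ex; rewrite Ex => /addIr ->.
- by move=> Ex; rewrite Ex => /addIr ->.
Qed.

Lemma ex_common_parallel m m' : exists j, parallel j m = parallel j m'.
Proof.
case: m m' => [x y] [x' y']; have [<-|xx'] := eqVneq x x'; first by exists None.
exists (Some ((y' - y) / (x - x')))%R => /=.
have D : (x - x' != 0)%R by rewrite subr_eq0.
by field.
Qed.

Lemma sum_parallel2 j k f g : j != k ->
  \sum_m f (parallel j m) * g (parallel k m) = (\sum_s f s) * (\sum_s g s).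
Proof.
move=> jk; rewrite big_distrlr pair_bigA /=.
by rewrite [RHS](reindex _ (onW_bij _ (injF_bij (parallel_pair_inj jk)))).
Qed.

Lemma sum_parallel j f : \sum_m f (parallel j m) = #|F| * \sum_s f s.
Proof.
have [k jk] : exists k, j != k by case: j => [t|]; [exists None|exists (Some 0%R)].
have := sum_parallel2 f (fun=> 1) jk; rewrite sum_nat_const muln1 mulnC => <-.
by apply: eq_bigr => m _; rewrite muln1.
Qed.

(* The lines of AG(2, F), here called segments, carry the weights [w]: [line_sum m] is the weight
   of the segments through [m].  In a line class of a Hjelmslev plane the points [m] are the
   lines of the class. *)
Section Weights.
Variable w : option F -> F -> nat.

Definition line_sum m : nat := \sum_j w j (parallel j m).
Definition row_sum j : nat := \sum_s w j s.
Definition row_sqr j : nat := \sum_s w j s ^ 2.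
Definition total : nat := \sum_j row_sum j.

Lemma sum_line_sum : \sum_m line_sum m = #|F| * total.
Proof.
rewrite exchange_big /total big_distrr /=; apply: eq_bigr => j _.
exact: sum_parallel.
Qed.

Lemma segment_sum j s :
  \sum_(m | parallel j m == s) line_sum m + row_sum j = total + #|F| * w j s.
Proof.
have row k : \sum_(m | parallel j m == s) w k (parallel k m) =
    if k == j then #|F| * w j s else row_sum k.
  rewrite sum_cond_mul.
  have [->|kj] := eqVneq k j.
    by rewrite (sum_parallel j (fun s' => (s' == s) * w j s')) sum_eq_mul.
  rewrite (sum_parallel2 (fun s' => s' == s)) 1?eq_sym //.
  by rewrite -(eq_bigr _ (fun s' _ => muln1 (s' == s))) (sum_eq_mul s (fun=> 1)) mul1n.
rewrite exchange_big (eq_bigr _ (fun k _ => row k)) (bigD1 j) //= eqxx.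
rewrite (eq_bigr row_sum) => [|k /negbTE-> //].
by rewrite [total](bigD1 j) //= addnC addnA addnAC.
Qed.

Lemma second_moment :
  \sum_m line_sum m ^ 2 + \sum_j row_sum j ^ 2 = #|F| * \sum_j row_sqr j + total ^ 2.
Proof.
have -> : \sum_m line_sum m ^ 2 =
    \sum_j \sum_k \sum_m w j (parallel j m) * w k (parallel k m).
  rewrite (eq_bigr (fun j => \sum_m \sum_k w j (parallel j m) * w k (parallel k m))); last first.
    by move=> j _; rewrite exchange_big.
  rewrite exchange_big; apply: eq_bigr => m _.
  by rewrite -mulnn big_distrlr.
rewrite -mulnn [total * total]big_distrlr big_distrr /= -!big_split; apply: eq_bigr => j _.
rewrite (bigD1 j) //= [X in _ = _ + X](bigD1 j) //=.
rewrite (sum_parallel j (fun s => w j s * w j s)) (eq_bigr (fun k => row_sum j * row_sum k)).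
  by rewrite mulnn addnAC addnA; under eq_bigr do rewrite mulnn.
by move=> k kj; apply: sum_parallel2; rewrite eq_sym.
Qed.

End Weights.
End AffinePlane.

Section Deficits.
Variables (F : finFieldType) (w : option F -> F -> nat) (c : nat).
Implicit Types (j : option F) (m : F * F) (s : F).
Local Notation q := #|F|.

Definition capped : Prop := forall m, line_sum w m <= c.
Definition deficit m : nat := c - line_sum w m.
Definition segment_deficit j s : nat := \sum_(m | parallel j m == s) deficit m.

Hypothesis w_capped : capped.

Lemma deficitK m : deficit m + line_sum w m = c.
Proof. exact: subnK. Qed.

Lemma sum_deficit : \sum_m deficit m + q * total w = c * q ^ 2.
Proof.
rewrite -sum_line_sum -big_split (eq_bigr _ (fun m _ => deficitK m)) sum_nat_const.
by rewrite card_prod mulnC mulnn.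
Qed.

Lemma segment_deficitE j s :
  segment_deficit j s + total w + q * w j s = c * q + row_sum w j.
Proof.
rewrite -addnA -segment_sum addnA -big_split (eq_bigr _ (fun m _ => deficitK m)).
by rewrite sum_cond_mul (sum_parallel j (fun s' => (s' == s) * c)) (sum_eq_mul s (fun=> c)) mulnC.
Qed.

Lemma sum_segment_deficit j : \sum_s segment_deficit j s = \sum_m deficit m.
Proof. by rewrite [RHS](partition_big (parallel j) xpredT). Qed.

Lemma total_le : total w <= c * q.
Proof.
have q_gt0 : 0 < q by apply/card_gt0P; exists 0%R.
by rewrite -(leq_pmul2r q_gt0) -mulnA mulnn -sum_deficit mulnC leq_addl.
Qed.

Lemma sum_deficit_sqr :
  \sum_m deficit m ^ 2 + \sum_j row_sum w j ^ 2 =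
  q * \sum_j row_sqr w j + (c * q - total w) ^ 2.
Proof.
have /= E : \sum_m (deficit m ^ 2 + 2 * c * line_sum w m) =
    \sum_(m : F * F) (c ^ 2 + line_sum w m ^ 2).
  by apply: eq_bigr => m _; have := deficitK m; nia.
move: E; rewrite !big_split sum_nat_const card_prod -big_distrr /= sum_line_sum.
have cq := subnK total_le; move: (c * q - total w) cq => x cq.
have -> : q * q * c ^ 2 = (x + total w) ^ 2 by rewrite cq; ring.
have -> : 2 * c * (q * total w) = 2 * (x + total w) * total w by rewrite cq; ring.
have := second_moment w; rewrite sqrnD.
move: (\sum_m line_sum w m ^ 2) (#|F| * _) (total w) (\sum_m deficit m ^ 2).
by move: (\sum_j row_sum w j ^ 2) => R L Q N D; nia.
Qed.

Lemma pair_deficit j m m' : parallel j m = parallel j m' -> m != m' ->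
  deficit m + deficit m' <= segment_deficit j (parallel j m').
Proof.
move=> jm mm'; rewrite /segment_deficit (bigD1 m) ?jm //= leq_add2l.
by rewrite (bigD1 m') /= ?eqxx 1?eq_sym // leq_addr.
Qed.

Lemma deficit_le_segment j m : deficit m <= segment_deficit j (parallel j m).
Proof. by rewrite /segment_deficit (bigD1 m) //= leq_addr. Qed.

Lemma deficit_residue (b : nat) j : (forall m, deficit m <= b) ->
  \sum_m deficit m ^ 2 + b.-1 * \sum_s ~~ (b %| segment_deficit j s)
  <= b * \sum_m deficit m.
Proof.
move=> h_le; rewrite -(sum_segment_deficit j) [\sum_m _ ^ 2](partition_big (parallel j) xpredT) //=.
rewrite !big_distrr -big_split; apply: leq_sum => s _.
exact: (sum_sqr_residue (P := fun m => parallel j m == s) (fun m _ => h_le m)).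
Qed.

End Deficits.

(** * Line classes over the field of order four *)

(* The numbers of points on the four segments of a point class of size [n], up to order; a class
   of at most four points is taken to have no two points on a segment, as is the case in a line
   class with more than 20 points. *)
Definition profile (n : nat) : seq nat :=
  nth [::] [:: [:: 0; 0; 0; 0]; [:: 1; 0; 0; 0]; [:: 1; 1; 0; 0]; [:: 1; 1; 1; 0];
               [:: 1; 1; 1; 1]; [:: 2; 2; 1; 0]; [:: 2; 2; 2; 0]] n.

Lemma perm_profile_light (r : seq nat) :
  size r = 4 -> all (leq^~ 1) r -> perm_eq r (profile (sumn r)).
Proof.
case: r => [|a [|b [|c [|d []]]]] // _ /and5P[].
by case: a => [|[]] // _; case: b => [|[]] // _; case: c => [|[]] // _; case: d => [|[]].
Qed.

Lemma perm_profile_heavy (r : seq nat) : size r = 4 -> all (leq^~ 2) r -> count (ltn 0) r = 3 ->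
  4 < sumn r -> perm_eq r (profile (sumn r)).
Proof.
case: r => [|a [|b [|c [|d []]]]] // _ /and5P[].
case: a => [|[|[]]] // _; case: b => [|[|[]]] // _; case: c => [|[|[]]] // _;
  by case: d => [|[|[]]] //= _ _.
Qed.

(* [ns] stands for the sizes of the five point classes: the segments of a class of size [n] have
   the deficits [profile_deficits ns n], and [profile_deficit_sqr ns] is the second moment of the
   deficits of the lines. *)
Definition profile_deficits (ns : seq nat) (n : nat) : seq nat :=
  [seq 24 + n - (sumn ns + 4 * x) | x <- profile n].

Definition profile_deficit_sqr (ns : seq nat) : nat :=
  (24 - sumn ns) ^ 2 + sumn [seq 4 * sumn [seq x ^ 2 | x <- profile n] - n ^ 2 | n <- ns].

Definition residue_bound (ns : seq nat) (b : nat) : bool :=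
  has (fun n => all (leq^~ b) (profile_deficits ns n)) ns ==>
  all (fun n => profile_deficit_sqr ns +
         b.-1 * count (fun d => ~~ (b %| d)) (profile_deficits ns n)
         <= b * (96 - 4 * sumn ns)) ns.

Definition capped_profile (ns : seq nat) : bool :=
  all (fun n => all (fun x => sumn ns + 4 * x <= 24 + n) (profile n)) ns.

Definition high_types : seq (seq nat) :=
  [:: [:: 5; 4; 4; 4; 4]; [:: 5; 5; 5; 3; 3]; [:: 6; 4; 4; 4; 4];
      [:: 6; 4; 4; 4; 3]; [:: 6; 6; 3; 3; 3]].

Fixpoint words (b k : nat) : seq (seq nat) :=
  if k is k'.+1 then [seq n :: ns | n <- iota 0 b.+1, ns <- words b k'] else [:: [::]].

Lemma mem_words (b : nat) (ns : seq nat) : all (leq^~ b) ns -> ns \in words b (size ns).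
Proof.
elim: ns => // n ns IHns /andP[nb /IHns ns_words].
by apply: (allpairs_f cons) ns_words; rewrite mem_iota.
Qed.

Lemma residue_bound_types :
  all (fun ns => all (residue_bound ns) [:: 2; 3; 4; 5] ==>
         (if 20 < sumn ns then has (perm_eq ns) high_types
          else ~~ perm_eq ns [:: 5; 5; 5; 5; 0]))
      [seq ns <- [seq ns <- words 6 5 | 19 < sumn ns] | capped_profile ns].
Proof. by vm_compute. Qed.

Section OrderFour.
Variables (F : finFieldType) (w : option F -> F -> nat).
Hypotheses (card_F : #|F| = 4) (w_capped : capped w 6).
Implicit Types (j : option F) (s : F) (b : nat).
Local Notation d := (deficit w 6).

Lemma sum_deficit_card4 : \sum_m d m + 4 * total w = 96.
Proof. by have := sum_deficit w_capped; rewrite card_F. Qed.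

Lemma segment_deficit_card4 j s :
  segment_deficit w 6 j s + total w + 4 * w j s = 24 + row_sum w j.
Proof. by have := segment_deficitE w_capped j s; rewrite card_F. Qed.

Lemma sum_deficit_sqr_card4 : \sum_m d m ^ 2 + \sum_j row_sum w j ^ 2 =
  4 * \sum_j row_sqr w j + (24 - total w) ^ 2.
Proof. by have := sum_deficit_sqr w_capped; rewrite card_F. Qed.

Definition row_values j : seq nat := [seq w j s | s : F].

Definition row_sums : seq nat := [seq row_sum w j | j : option F].

Hypothesis row_profile : forall j, perm_eq (row_values j) (profile (row_sum w j)).

Lemma sum_profile (f : nat -> nat) j :
  \sum_s f (w j s) = sumn [seq f x | x <- profile (row_sum w j)].
Proof.
rewrite -(perm_sumn (perm_map f (row_profile j))) -sumn_image; congr sumn.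
by rewrite -map_comp.
Qed.

Lemma profile_row_sum_le6 j : row_sum w j <= 6.
Proof.
rewrite leqNgt; apply/negP => n7; have /perm_size := row_profile j.
by rewrite /profile nth_default // size_map -cardE card_F.
Qed.

Lemma sumn_row_sums : sumn row_sums = total w. Proof. exact: sumn_image. Qed.

Lemma perm_segment_deficits j :
  perm_eq [seq segment_deficit w 6 j s | s : F] (profile_deficits row_sums (row_sum w j)).
Proof.
have -> : [seq segment_deficit w 6 j s | s : F] =
    [seq 24 + row_sum w j - (sumn row_sums + 4 * x) | x <- row_values j].
  rewrite -map_comp sumn_row_sums; apply: eq_map => s /=.
  by have := segment_deficit_card4 j s; lia.
exact/perm_map/row_profile.
Qed.

Lemma sum_deficit_sqr_profile : \sum_m d m ^ 2 = profile_deficit_sqr row_sums.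
Proof.
have profile_sqr j : row_sum w j ^ 2 <= 4 * row_sqr w j.
  rewrite /row_sqr (sum_profile (fun x => x ^ 2)).
  by move: (row_sum w j) (profile_row_sum_le6 j) => [|[|[|[|[|[|[|]]]]]]].
apply: (@addIn (\sum_j row_sum w j ^ 2)); rewrite sum_deficit_sqr_card4 addnC.
rewrite /profile_deficit_sqr sumn_row_sums -addnA -map_comp sumn_image -big_split; congr addn.
rewrite big_distrr; apply: eq_bigr => j _ /=.
by rewrite -sum_profile subnK.
Qed.

Lemma deficit_le_profile b j : all (leq^~ b) (profile_deficits row_sums (row_sum w j)) ->
  forall m, d m <= b.
Proof.
rewrite -(perm_all _ (perm_segment_deficits j)) => /allP D_le m.
apply: leq_trans (deficit_le_segment w 6 j m) (D_le _ _).
exact: image_f.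
Qed.

Lemma row_sums_residue_bound b : residue_bound row_sums b.
Proof.
apply/implyP => /hasP[_ /mapP[j _ ->] /deficit_le_profile d_le].
apply/allP => _ /mapP[k _ ->]; rewrite -sum_deficit_sqr_profile sumn_row_sums.
have -> : 96 - 4 * total w = \sum_m d m by rewrite -sum_deficit_card4 addnK.
have := deficit_residue k d_le.
by rewrite -(permP (perm_segment_deficits k)) count_image.
Qed.

Lemma row_sums_capped_profile : capped_profile row_sums.
Proof.
apply/allP => _ /mapP[j _ ->]; rewrite -(perm_all _ (row_profile j)).
apply/allP => _ /mapP[s _ ->]; rewrite sumn_row_sums.
by have := segment_deficit_card4 j s; lia.
Qed.

Lemma row_sums_in_words : row_sums \in words 6 5.
Proof.
have /mem_words : all (leq^~ 6) row_sums.
  by apply/allP => _ /mapP[j _ ->]; apply: profile_row_sum_le6.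
by rewrite size_map -cardE card_option card_F.
Qed.

Lemma row_sums_high_types : 19 < total w ->
  if 20 < total w then has (perm_eq row_sums) high_types
  else ~~ perm_eq row_sums [:: 5; 5; 5; 5; 0].
Proof.
rewrite -sumn_row_sums => big; have /allP/(_ row_sums) := residue_bound_types.
rewrite !mem_filter row_sums_capped_profile big row_sums_in_words => /(_ isT)/implyP; apply.
by apply/allP => b _; apply: row_sums_residue_bound.
Qed.
End OrderFour.

Section RowSumsFour.
Variables (F : finFieldType) (w : option F -> F -> nat).
Hypotheses (card_F : #|F| = 4) (w_capped : capped w 6).
Implicit Types (j : option F) (m : F * F).
Local Notation d := (deficit w 6).
Local Notation D := (segment_deficit w 6).

Section Fours.
Hypothesis row_sum_fours : forall j, row_sum w j = 4.

Lemma total_fours : total w = 20.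
Proof.
by rewrite /total (eq_bigr _ (fun j _ => row_sum_fours j)) sum_nat_const card_option card_F.
Qed.

Lemma sum_deficit_fours : \sum_m d m = 16.
Proof. by have := sum_deficit_card4 card_F w_capped; rewrite total_fours; lia. Qed.

Lemma sum_deficit_sqr_fours : \sum_m d m ^ 2 + 64 = 4 * \sum_j row_sqr w j.
Proof.
have := sum_deficit_sqr_card4 card_F w_capped; rewrite total_fours.
under [\sum_j row_sum w j ^ 2]eq_bigr do rewrite row_sum_fours.
by rewrite sum_nat_const card_option card_F; lia.
Qed.

(* Every point other than [m0] shares a segment, of deficit at most 8, with [m0]. *)
Lemma sum_deficit_sqr_fours_lt64 m0 : 4 < d m0 -> \sum_m d m ^ 2 < 64.
Proof.
move=> d_m0; have d_le m : m != m0 -> d m <= 8 - d m0.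
  move=> mm0; have [j jm] := ex_common_parallel m m0; have := pair_deficit w 6 jm mm0.
  have := segment_deficit_card4 card_F w_capped j (parallel j m0).
  by rewrite row_sum_fours total_fours; lia.
have := sum_sqr_apex (P := xpredT) isT (fun m _ => d_le m).
have : d m0 <= 6 by exact: leq_subr.
by rewrite sum_deficit_fours; nia.
Qed.

Lemma sum_row_sqr_fours_le32 : \sum_j row_sqr w j <= 32.
Proof.
have := sum_deficit_sqr_fours; have [/forallP d_le|/forallPn[m0]] := boolP [forall m, d m <= 4].
  by have := sum_sqr_le (P := xpredT) (fun m _ => d_le m); rewrite sum_deficit_fours; lia.
by rewrite -ltnNge => /sum_deficit_sqr_fours_lt64; lia.
Qed.

Lemma line_sum_fours m : \sum_j row_sqr w j = 32 -> line_sum w m = 2 \/ line_sum w m = 6.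
Proof.
move=> sqr32; have := sum_deficit_sqr_fours; rewrite sqr32 => d_sqr.
have d_le m' : d m' <= 4 by rewrite leqNgt; apply/negP => /sum_deficit_sqr_fours_lt64; lia.
have := deficitK w_capped m; have := sum_sqr_eq (P := xpredT) (fun m' _ => d_le m').
by rewrite sum_deficit_fours => /(_ _ m isT)[]; lia.
Qed.

End Fours.

Section FoursAndThree.
Variable j0 : option F.
Hypothesis row_sum_fours_and_three : forall j, row_sum w j = if j == j0 then 3 else 4.

Lemma row_sum_j0 : row_sum w j0 = 3.
Proof. by rewrite row_sum_fours_and_three eqxx. Qed.

Lemma row_sum_neq_j0 j : j != j0 -> row_sum w j = 4.
Proof. by move=> /negbTE jj0; rewrite row_sum_fours_and_three jj0. Qed.

Lemma sum_row_sum_fours_and_three (f : nat -> nat) :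
  \sum_j f (row_sum w j) = f 3 + 4 * f 4.
Proof.
rewrite (bigD1 j0) //= row_sum_j0 (eq_bigr (fun=> f 4)) => [|j /row_sum_neq_j0 -> //].
by rewrite sum_nat_const cardC1 card_option card_F.
Qed.

Lemma total_fours_and_three : total w = 19.
Proof. exact: (sum_row_sum_fours_and_three id). Qed.

(* A point of deficit more than 4 lies on a segment of deficit 8 in the class [j0], and on
   segments of deficit at most 9 in the other classes. *)
Lemma sum_deficit_sqr_fours_and_three_le82 : \sum_m d m ^ 2 <= 82.
Proof.
have d20 : \sum_m d m = 20.
  by have := sum_deficit_card4 card_F w_capped; rewrite total_fours_and_three; lia.
have [/forallP d_le|/forallPn[m0]] := boolP [forall m, d m <= 4].
  by have := sum_sqr_le (P := xpredT) (fun m _ => d_le m); rewrite d20; lia.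
rewrite -ltnNge => d_m0; pose s0 := parallel j0 m0.
have on_sum : D j0 s0 = 8.
  have := segment_deficit_card4 card_F w_capped j0 s0; rewrite row_sum_j0 total_fours_and_three.
  by have := deficit_le_segment w 6 j0 m0; rewrite -/s0; lia.
have split f : \sum_m f m = \sum_(m | parallel j0 m == s0) f m + \sum_(m | parallel j0 m != s0) f m.
  exact: bigID.
have off_sum : \sum_(m | parallel j0 m != s0) d m = 12.
  by move: d20; rewrite split -/(D j0 s0) on_sum; lia.
have on_le m : parallel j0 m == s0 -> m != m0 -> d m <= 8 - d m0.
  by move=> /eqP jm mm0; have := pair_deficit w 6 jm mm0; rewrite -/s0 on_sum; lia.
have off_le m : parallel j0 m != s0 -> d m <= 9 - d m0.
  move=> jm; have mm0 : m != m0 by apply: contraNneq jm => ->.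
  have [j jm'] := ex_common_parallel m m0.
  have jj0 : j != j0 by apply: contraNneq jm => E; rewrite /s0 -E jm'.
  have := segment_deficit_card4 card_F w_capped j (parallel j m0).
  by have := pair_deficit w 6 jm' mm0; rewrite row_sum_neq_j0 // total_fours_and_three; lia.
have := sum_sqr_apex (P := fun m => parallel j0 m == s0) (eqxx s0) on_le.
have := sum_sqr_le (P := fun m => parallel j0 m != s0) off_le.
rewrite split -/(D j0 s0) on_sum off_sum.
have d_le6 : d m0 <= 6 := leq_subr _ _.
have : d m0 = 5 \/ d m0 = 6 by lia.
by case=> ->; lia.
Qed.

Lemma sum_row_sqr_fours_and_three_le28 : \sum_(j | j != j0) row_sqr w j <= 28.
Proof.
have row_sqr_j0 : 3 <= row_sqr w j0.
  by rewrite -row_sum_j0; apply: leq_sum => s _; nia.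
have even_sqr : ~~ odd (\sum_(j | j != j0) row_sqr w j).
  rewrite odd_sum big1 // => j /row_sum_neq_j0 w4.
  by rewrite odd_sum (eq_bigr (odd \o w j)) => [|s _]; rewrite ?oddX // -odd_sum -/(row_sum w j) w4.
have := sum_deficit_sqr_card4 card_F w_capped.
rewrite total_fours_and_three (sum_row_sum_fours_and_three (fun n => n ^ 2)).
rewrite (bigD1 j0) //= -[(24 - 19) ^ 2]/25 -[3 ^ 2 + _]/73.
move: even_sqr sum_deficit_sqr_fours_and_three_le82 row_sqr_j0.
move: (\sum_(j | j != j0) _) (\sum_m _) (row_sqr w j0) => Q E Q0 even_Q E_le Q0_ge E_eq.
have : Q <= 29 by lia.
by rewrite leq_eqVlt => /predU1P[Q29|//]; rewrite Q29 in even_Q.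
Qed.

End FoursAndThree.
End RowSumsFour.

(** * Projective planes *)

Definition projective_plane (q : nat) (P L : finType) (inc : P -> L -> bool) : Prop :=
  (forall c c', \sum_l (inc c l && inc c' l) = 1 + q * (c == c')) /\
  (forall l l', \sum_c (inc c l && inc c l') = 1 + q * (l == l')).

Section ProjectivePlane.
Variables (q : nat) (P L : finType) (inc : P -> L -> bool).
Hypothesis plane : projective_plane q inc.
Implicit Types (c : P) (l : L).

Lemma join_points c c' : exists2 l, inc c l & inc c' l.
Proof.
have [/(_ c c') joins _] := plane.
case: (pickP (fun l => inc c l && inc c' l)) => [l /andP[]|none]; first by exists l.
by move: joins; rewrite big1 // => l _; rewrite none.
Qed.

Lemma meet_lines l l' : exists2 c, inc c l & inc c l'.
Proof.
have [_ /(_ l l') meets] := plane.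
case: (pickP (fun c => inc c l && inc c l')) => [c /andP[]|none]; first by exists c.
by move: meets; rewrite big1 // => c _; rewrite none.
Qed.

Lemma eq_line c c' l l' : inc c l -> inc c' l -> inc c l' -> inc c' l' -> c != c' -> l = l'.
Proof.
move=> cl c'l cl' c'l' /negbTE cc'; have [/(_ c c') + _] := plane.
rewrite cc' muln0 (bigD1 l) //= cl c'l; have [->//|ll'] := eqVneq l l'.
by rewrite (bigD1 l') /= ?cl' ?c'l' 1?eq_sym.
Qed.

Lemma sum_line_const l (k : nat) : \sum_(c | inc c l) k = q.+1 * k.
Proof.
have [_ /(_ l l)] := plane; rewrite eqxx muln1 add1n => <-.
by rewrite big_distrl sum_cond_mul; apply: eq_bigr => c _; rewrite andbb.
Qed.

Lemma sum_pencil_const c (k : nat) : \sum_(l | inc c l) k = q.+1 * k.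
Proof.
have [/(_ c c) + _] := plane; rewrite eqxx muln1 add1n => <-.
by rewrite big_distrl sum_cond_mul; apply: eq_bigr => l _; rewrite andbb.
Qed.

Lemma exchange_flags (f : P -> L -> nat) :
  \sum_l \sum_(c | inc c l) f c l = \sum_c \sum_(l | inc c l) f c l.
Proof. exact: exchange_big_dep. Qed.

Lemma sum_pencil c (f : P -> nat) :
  \sum_(l | inc c l) \sum_(c' | inc c' l) f c' = \sum_c' f c' + q * f c.
Proof.
have [joins _] := plane; rewrite sum_cond_mul.
rewrite (eq_bigr (fun l => \sum_c' (inc c l && inc c' l) * f c')) => [|l _]; last first.
  by rewrite sum_cond_mul big_distrr; apply: eq_bigr => c' _ /=; rewrite mulnA mulnb.
rewrite exchange_big; under eq_bigr do rewrite -big_distrl /= joins mulnDl mul1n.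
rewrite big_split /=; congr addn; under eq_bigr do rewrite -mulnA [c == _]eq_sym.
by rewrite -big_distrr sum_eq_mul.
Qed.

Lemma card_points c : #|P| = q ^ 2 + q + 1.
Proof.
have := sum_pencil c (fun=> 1); rewrite sum_nat_const muln1.
rewrite (eq_bigr _ (fun l _ => sum_line_const l 1)) sum_pencil_const muln1.
by move: #|P|; nia.
Qed.

Lemma card_lines : #|L| = #|P|.
Proof.
have := exchange_flags (fun _ _ => 1).
rewrite (eq_bigr _ (fun l _ => sum_line_const l 1)) (eq_bigr _ (fun c _ => sum_pencil_const c 1)).
by rewrite !sum_nat_const muln1 => /eqP; rewrite eqn_pmul2r // => /eqP.
Qed.

End ProjectivePlane.

(** * Sizes of point classes *)

Lemma perm_four_fives (s : seq nat) : size s = 5 -> all (leq^~ 5) s -> 0 \in s -> sumn s = 20 ->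
  perm_eq s [:: 5; 5; 5; 5; 0].
Proof.
move=> size_s le5 /perm_to_rem s0; rewrite (perm_size s0) in size_s.
rewrite (perm_all _ s0) in le5; rewrite (perm_sumn s0); rewrite (permPl s0).
move: (rem 0 s) size_s le5 => [|a [|b [|c [|d []]]]] //= _ /and5P[a5 b5 c5 d5 _] sum20.
have [-> -> -> ->] : [/\ a = 5, b = 5, c = 5 & d = 5] by split; lia.
by [].
Qed.

Section ClassWeights.
Variables (P L : finType) (inc : P -> L -> bool) (n : P -> nat).
Implicit Types (c e x y z : P) (k l m : L).

Definition weights l : seq nat := [seq n c | c in [pred c | inc c l]].
Definition weight l : nat := \sum_(c | inc c l) n c.
Definition high l : bool := 20 < weight l.

Definition size_count (k : nat) : nat := #|[pred c | n c == k]|.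
Definition light_count : nat := #|[pred c | n c <= 2]|.
Definition line_light_count l : nat := #|[pred c | inc c l & n c <= 2]|.

Lemma size_countE (k : nat) : size_count k = \sum_c (n c == k).
Proof. by rewrite sum_bool. Qed.

Lemma light_countE : light_count = \sum_c (n c <= 2).
Proof. by rewrite sum_bool. Qed.

Lemma line_light_countE l : line_light_count l = \sum_(c | inc c l) (n c <= 2).
Proof. by rewrite -big_mkcondr sum1_card. Qed.

Lemma sumn_weights l : sumn (weights l) = weight l.
Proof. by rewrite /weights sumn_image. Qed.

Lemma count_weights (A : pred nat) l : count A (weights l) = #|[pred c | inc c l & A (n c)]|.
Proof. by rewrite count_image -sum1_card [RHS]big_mkcondr. Qed.

Lemma mem_weights c l : inc c l -> n c \in weights l.
Proof. by move=> cl; apply: image_f; rewrite inE. Qed.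

Hypothesis high_weights : forall l, high l -> has (perm_eq (weights l)) high_types.

Variant high_spec l : nat -> Prop :=
  | High54444 of perm_eq (weights l) [:: 5; 4; 4; 4; 4] : high_spec l 21
  | High55533 of perm_eq (weights l) [:: 5; 5; 5; 3; 3] : high_spec l 21
  | High64444 of perm_eq (weights l) [:: 6; 4; 4; 4; 4] : high_spec l 22
  | High64443 of perm_eq (weights l) [:: 6; 4; 4; 4; 3] : high_spec l 21
  | High66333 of perm_eq (weights l) [:: 6; 6; 3; 3; 3] : high_spec l 21.

Lemma highP l : high l -> high_spec l (weight l).
Proof.
move=> /high_weights; rewrite /= orbF -sumn_weights.
by case/or4P=> [||| /orP[]] types; rewrite (perm_sumn types); constructor.
Qed.

Definition type54444 l : bool := perm_eq (weights l) [:: 5; 4; 4; 4; 4].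
Definition type55533 l : bool := perm_eq (weights l) [:: 5; 5; 5; 3; 3].

Lemma weight_le22 l : weight l <= 22.
Proof. by case: (boolP (high l)) => [/highP[]|]; rewrite /high; lia. Qed.

Lemma high_five_type c l : inc c l -> n c = 5 -> high l -> type54444 l \/ type55533 l.
Proof.
move=> cl n5 /highP types; have := mem_weights cl; rewrite n5.
by case: types => types; rewrite (perm_mem types) //; [left|right].
Qed.

Lemma type55533_odd c l : type55533 l -> inc c l -> n c = 5 \/ n c = 3.
Proof. by move=> types /mem_weights; rewrite (perm_mem types) !inE; lia. Qed.

Lemma type54444_four c c' l : type54444 l -> inc c l -> inc c' l -> c != c' ->
  n c = 5 -> n c' = 4.
Proof.
move=> types cl c'l cc' n5; have := mem_weights c'l; rewrite (perm_mem types) !inE !orbb.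
case/orP=> /eqP // n5'; suff : 1 < count (pred1 5) (weights l) by rewrite (permP types).
by rewrite count_weights; apply/card_gt1P; exists c, c'; rewrite !inE cl c'l n5 n5'.
Qed.

Lemma type55533_second_five c l : type55533 l -> exists c', [/\ inc c' l, c != c' & n c' = 5].
Proof.
move=> types; have : 1 < count (pred1 5) (weights l) by rewrite (permP types).
rewrite count_weights => /card_gt1P[x [y]]; rewrite !inE.
move=> [/andP[xl /eqP nx] /andP[yl /eqP ny] xy].
by have [cx|cx] := eqVneq c x; [exists y; rewrite cx | exists x].
Qed.

Definition heavy l : nat := #|[pred c | inc c l & 4 < n c]|.

(* Discharging: a high line splits 6 units between its classes with more than four points. *)
Definition share l : nat := if high l then 6 %/ heavy l else 0.

Lemma heavyE l : heavy l = count (fun v => 4 < v) (weights l).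
Proof. by rewrite count_weights. Qed.

Lemma share_heavy l : share l * heavy l = 6 * high l.
Proof.
rewrite /share heavyE; case: (boolP (high l)) => // /highP[] types.
all: by rewrite !(permP types).
Qed.

Hypothesis plane : projective_plane 4 inc.

Hypothesis sum_n : \sum_c n c = 84.

Lemma card_classes : #|P| = 21.
Proof.
have [c _|P0] := pickP P; first exact: (card_points plane c).
by move: sum_n; rewrite big1 // => c; have := P0 c.
Qed.

Lemma sum_weight_pencil c : \sum_(l | inc c l) weight l = 84 + 4 * n c.
Proof. by rewrite -sum_n -(sum_pencil plane). Qed.

Lemma card_six_le3 : size_count 6 <= 3.
Proof.
have [c /eqP n6|none] := pickP [pred c | n c == 6]; last by rewrite /size_count eq_card0.
have := sum_pencil plane c (fun x => n x == 6 : nat); rewrite n6 -size_countE => sixes.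
suff : \sum_(l | inc c l) (\sum_(x | inc x l) (n x == 6) + weight l) <= \sum_(l | inc c l) 23.
  rewrite big_split /= sixes sum_weight_pencil n6 (sum_pencil_const plane).
  by lia.
apply: leq_sum => l cl; rewrite -(count_image [pred x | inc x l] n (pred1 6)) -/(weights l).
have [/highP[] types|] := boolP (high l); rewrite ?(permP types) //.
rewrite /high -leqNgt -sumn_weights => w20.
have : 6 * count (pred1 6) (weights l) <= sumn (weights l).
  by elim: (weights l) => //= x s IHs; have [->|_] := eqVneq x 6; lia.
by move: w20; move: (count _ _) (sumn _); lia.
Qed.

Lemma share_six c : n c = 6 -> 24 <= \sum_(l | inc c l) share l.
Proof.
move=> n6; suff : \sum_(l | inc c l) 3 * weight l <= \sum_(l | inc c l) (share l + 60).
  rewrite -big_distrr /= sum_weight_pencil n6 big_split /= (sum_pencil_const plane).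
  by lia.
apply: leq_sum => l cl; have := mem_weights cl; rewrite n6 /share heavyE.
case: (boolP (high l)) => [/highP[] types|]; last by rewrite /high; lia.
all: by rewrite (perm_mem types) ?(permP types).
Qed.

Hypothesis n_le6 : forall c, n c <= 6.

Lemma card_light_le : 126 + 10 * light_count <=
  6 * size_count 4 + 14 * size_count 5 + 22 * size_count 6.
Proof.
have : \sum_c (6 + (n c <= 2) * 10 + n c * 8) <=
    \sum_c (32 + (n c == 4) * 6 + (n c == 5) * 14 + (n c == 6) * 22).
  by apply: leq_sum => c _; move: (n c) (n_le6 c) => [|[|[|[|[|[|[|]]]]]]].
rewrite !big_split /= -!big_distrl /= !sum_nat_const -!size_countE -light_countE.
by rewrite sum_n card_classes; lia.
Qed.

Hypothesis weight_le_heavy : forall c l, inc c l -> 4 < n c -> weight l <= 16 + n c.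

Lemma five_low_line c : n c = 5 ->
  exists l0, [/\ inc c l0, weight l0 = 20 & forall l, inc c l -> high l = (l != l0)].
Proof.
move=> n5; have w21 l : inc c l -> weight l <= 21 by move=> /weight_le_heavy; rewrite n5; apply.
have /eqP/sum_nat_eq1[l0 [cl0 low0 low]] : \sum_(l | inc c l) (21 - weight l) = 1.
  have : \sum_(l | inc c l) (21 - weight l + weight l) = \sum_(l | inc c l) 21.
    by apply: eq_bigr => l /w21; lia.
  by rewrite big_split /= sum_weight_pencil n5 (sum_pencil_const plane); lia.
exists l0; split=> // [|l cl]; first by have := w21 l0 cl0; lia.
rewrite /high; have [->|/low/(_ cl)] := eqVneq l l0; have := w21 l cl; lia.
Qed.

Lemma sum_high_five c : n c = 5 -> \sum_(l | inc c l) high l = 4.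
Proof.
move=> /five_low_line[l0 [cl0 _ high_c]].
have : \sum_(l | inc c l) (high l + (l == l0)) = \sum_(l | inc c l) 1.
  by apply: eq_bigr => l /high_c ->; case: (l == l0).
rewrite (sum_pencil_const plane) big_split /= [X in _ + X](bigD1 l0) //= eqxx.
rewrite [X in _ + (_ + X)]big1 => [|l /andP[_ /negbTE->] //].
by lia.
Qed.

(* Through every further five of [l1], a line of type 54444 would meet [l2] in a four. *)
Lemma type55533_spread c c1 l1 l2 m : inc c l1 -> inc c l2 -> l1 != l2 ->
  type55533 l1 -> type55533 l2 -> inc c1 l1 -> c != c1 -> n c1 = 5 -> inc c1 m -> high m ->
  type55533 m.
Proof.
move=> cl1 cl2 l12 B1 B2 c1l1 cc1 n5 c1m hm; have [A|//] := high_five_type c1m n5 hm.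
have [t tm tl2] := meet_lines plane m l2.
have c1t : c1 != t.
  by apply: contraNneq l12 => E; rewrite -E in tl2; apply/eqP/(eq_line plane cl1 c1l1 cl2 tl2 cc1).
by case: (type55533_odd B2 tl2); rewrite (type54444_four A c1m tm c1t n5).
Qed.

Lemma no_mixed_five c l1 l2 k : n c = 5 -> inc c l1 -> inc c l2 -> inc c k -> l1 != l2 ->
  type55533 l1 -> type55533 l2 -> ~~ type54444 k.
Proof.
move=> n5 cl1 cl2 ck l12 B1 B2; apply/negP => A.
have [c1 [c1l1 cc1 n1]] := type55533_second_five c B1.
have [l0 [_ _ high_c1]] := five_low_line n1.
have [m [c1m ml0 ml1]] : exists m, [/\ inc c1 m, m != l0 & m != l1].
  have : ~~ ([pred m | inc c1 m] \subset [:: l0; l1]).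
    apply/negP => /subset_leq_card; rewrite -sum1_card (sum_pencil_const plane).
    by move/leq_trans/(_ (card_size _)).
  by case/subsetPn=> m; rewrite !inE negb_or => c1m /andP[]; exists m.
have Bm : type55533 m.
  by apply: (type55533_spread cl1 cl2 l12 B1 B2 c1l1 cc1 n1 c1m); rewrite high_c1.
have [x xm xk] := meet_lines plane m k.
have cx : c != x.
  by apply: contraNneq ml1 => E; rewrite -E in xm; apply/eqP/(eq_line plane xm c1m cl1 c1l1 cc1).
by case: (type55533_odd Bm xm); rewrite (type54444_four A ck xk cx n5).
Qed.

Hypothesis no_four_fives : forall l, ~~ perm_eq (weights l) [:: 5; 5; 5; 5; 0].

Definition odd_class c : bool := (n c == 5) || (n c == 3).

Section PureFive.
Variable c : P.
Hypotheses (n5 : n c = 5) (pure : forall l, inc c l -> high l -> type55533 l).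

Lemma pure_even_on_low_line l0 x : (forall l, inc c l -> high l = (l != l0)) ->
  ~~ odd_class x -> inc x l0.
Proof.
move=> high_c even_x; have [l cl xl] := join_points plane c x.
have [<- //|ll0] := eqVneq l l0; case/negP: even_x.
have Bl : type55533 l by apply: pure; rewrite ?high_c.
by rewrite /odd_class; case: (type55533_odd Bl xl) => ->.
Qed.

Lemma pure_even_unique x y : ~~ odd_class x -> ~~ odd_class y -> x = y.
Proof.
have [l0 [cl0 _ high_c]] := five_low_line n5.
have [l1 [l2 [cl1 cl2 l10 l20 l12]]] :
    exists l1 l2, [/\ inc c l1, inc c l2, l1 != l0, l2 != l0 & l1 != l2].
  have : 1 < #|[predD1 [pred l | inc c l] & l0]|.
    have := cardD1 l0 [pred l | inc c l].
    by rewrite -sum1_card (sum_pencil_const plane) inE cl0; move: #|_|; lia.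
  by case/card_gt1P=> l1 [l2]; rewrite !inE => -[/andP[? ?] /andP[? ?] ?]; exists l1, l2.
have B1 : type55533 l1 by apply: pure; rewrite ?high_c.
have B2 : type55533 l2 by apply: pure; rewrite ?high_c.
have [c1 [c1l1 cc1 n1]] := type55533_second_five c B1.
have [m0 [c1m0 _ high_c1]] := five_low_line n1.
have even_m0 z : ~~ odd_class z -> inc z m0.
  move=> even_z; have [m c1m zm] := join_points plane c1 z.
  have [<- //|mm0] := eqVneq m m0; case/negP: even_z.
  have hm : high m by rewrite high_c1.
  have Bm := type55533_spread cl1 cl2 l12 B1 B2 c1l1 cc1 n1 c1m hm.
  by rewrite /odd_class; case: (type55533_odd Bm zm) => ->.
move=> even_x even_y; apply/eqP/negPn/negP => xy.
have even_l0 z : ~~ odd_class z -> inc z l0 by apply: pure_even_on_low_line.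
have lm0 : l0 = m0 by apply: (eq_line plane _ _ _ _ xy); do ?[exact: even_l0|exact: even_m0].
by case/eqP: l10; rewrite -lm0 in c1m0; apply: (eq_line plane cl1 c1l1 cl0 c1m0).
Qed.

Lemma pure_odd e x : ~~ odd_class e -> x != e -> n x = 5 \/ n x = 3.
Proof.
move=> even_e xe; apply/pred2P; rewrite -/(odd_class x).
by apply: contraNT xe => /pure_even_unique/(_ even_e) ->.
Qed.

Lemma pure_ex_even : exists e, ~~ odd_class e.
Proof.
have [e even_e|odd_P] := pickP [pred x | ~~ odd_class x]; first by exists e.
have : odd (\sum_x n x) = odd (\sum_(x : P) 1).
  rewrite !odd_sum; apply: eq_bigr => x _.
  by case/orP: (negbFE (odd_P x)) => /eqP->.
by rewrite sum_n sum1_card card_classes.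
Qed.

Lemma pure_high_type l : high l -> type55533 l.
Proof.
have even_le1 : count (fun v => ~~ ((v == 5) || (v == 3))) (weights l) <= 1.
  rewrite count_weights; apply/card_le1_eqP => x y; rewrite !inE.
  by move=> /andP[_ even_x] /andP[_ even_y]; apply: pure_even_unique.
by move=> /highP[] types //; rewrite (permP types) in even_le1.
Qed.

Lemma pure_card_five e : ~~ odd_class e -> n e + 2 * size_count 5 = 24.
Proof.
move=> even_e; have : \sum_x (n x + (x == e) * 3) =
    \sum_x ((x == e) * n e + ((n x == 5) * 2 + 3)).
  apply: eq_bigr => x _; have [->|xe] := eqVneq x e.
    by move: even_e; rewrite /odd_class negb_or => /andP[/negbTE-> _]; lia.
  by case: (pure_odd even_e xe) => ->.
rewrite !big_split /= sum_n !sum_eq_mul sum_nat_const -big_distrl /= -size_countE.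
by rewrite card_classes; lia.
Qed.

Lemma pure_card_high : 3 * #|high| = 4 * size_count 5.
Proof.
have := exchange_flags inc (fun x l => high l * (n x == 5)).
rewrite (eq_bigr (fun l => 3 * high l)) => [|l _]; last first.
  rewrite -big_distrr -big_mkcondr sum1_card -(count_weights (pred1 5)) mulnC.
  by case: (boolP (high l)) => [/pure_high_type types|_]; rewrite ?(permP types) ?muln0.
rewrite -big_distrr sum_bool /= => ->; rewrite size_countE big_distrr; apply: eq_bigr => x _.
rewrite -big_distrl /=; have [n5'|_] := eqVneq (n x) 5; last by rewrite !muln0.
by rewrite sum_high_five.
Qed.

Lemma no_pure_five : False.
Proof.
have [e even_e] := pure_ex_even; have card_five := pure_card_five even_e.
have card_high := pure_card_high; have n_le := n_le6 e.
have [n6|n0] : n e = 6 \/ n e = 0 by move: card_high card_five; move: #|_|; lia.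
  have : \sum_(l | inc e l) weight l <= \sum_(l | inc e l) 20.
    apply: leq_sum => l el; rewrite leqNgt; apply/negP => /pure_high_type Bl.
    by case: (type55533_odd Bl el); rewrite n6.
  by rewrite sum_weight_pencil n6 (sum_pencil_const plane).
have [l0 [cl0 w20 high_c]] := five_low_line n5.
have el0 : inc e l0 by apply: pure_even_on_low_line.
case/negP: (no_four_fives l0); apply: perm_four_fives.
- by rewrite size_map -cardE -sum1_card (sum_line_const plane).
- apply/allP => _ /imageP[x _ ->].
  have [->|xe] := eqVneq x e; first by rewrite n0.
  by case: (pure_odd even_e xe) => ->.
- by rewrite -n0; apply: mem_weights.
- by rewrite sumn_weights.
Qed.

End PureFive.

Lemma share54444 l : high l -> type54444 l -> share l = 6.
Proof. by move=> hl types; rewrite /share hl heavyE (permP types). Qed.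

Lemma share55533 l : high l -> type55533 l -> share l = 2.
Proof. by move=> hl types; rewrite /share hl heavyE (permP types). Qed.

Lemma type55533_pencil_unique c l l' : n c = 5 -> inc c l -> inc c l' ->
  type55533 l -> type55533 l' -> l = l'.
Proof.
move=> n5 cl cl' B B'; apply/eqP/negPn/negP => ll'; apply: (no_pure_five n5) => k ck hk.
have [A|//] := high_five_type ck n5 hk.
by have := no_mixed_five n5 cl cl' ck ll' B B'; rewrite A.
Qed.

Lemma share_five c : n c = 5 -> 20 <= \sum_(l | inc c l) share l.
Proof.
move=> n5; suff : \sum_(l | inc c l) 6 * high l <=
    \sum_(l | inc c l) share l + 4 * #|[pred l | inc c l & type55533 l]|.
  have : #|[pred l | inc c l & type55533 l]| <= 1.
    apply/card_le1_eqP => l l'; rewrite !inE => /andP[cl B] /andP[cl' B'].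
    exact: (type55533_pencil_unique n5 cl').
  by rewrite -big_distrr /= sum_high_five //; move: #|_|; lia.
rewrite -sum1_card [X in _ + _ * X]big_mkcondr big_distrr -big_split /=; apply: leq_sum => l cl.
case: (boolP (high l)) => // hl; case: (high_five_type cl n5 hl) => types.
  by rewrite share54444.
by rewrite share55533 ?types.
Qed.

Hypothesis size_count_four_le : 12 * size_count 4 <=
  \sum_l (12 * ~~ high l + 4 * line_light_count l).

Lemma card_high_ge :
  20 * size_count 5 + 24 * size_count 6 <= 6 * #|high|.
Proof.
have -> : 6 * #|high| = \sum_c (4 < n c) * \sum_(l | inc c l) share l.
  rewrite -sum_bool big_distrr /=.
  rewrite (eq_bigr (fun l => \sum_(c | inc c l) (4 < n c) * share l)) => [|l _]; last first.
    by rewrite -share_heavy -big_distrl -big_mkcondr sum1_card mulnC.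
  by rewrite (exchange_flags inc); apply: eq_bigr => c _; rewrite big_distrr.
rewrite !size_countE !big_distrr -big_split /=; apply: leq_sum => c _.
have [n5|_] := eqVneq (n c) 5; first by rewrite n5 mul1n share_five.
by have [n6|_] := eqVneq (n c) 6; first by rewrite n6 mul1n share_six.
Qed.

Lemma card_high_le :
  12 * size_count 4 + 12 * #|high| <= 252 + 20 * light_count.
Proof.
have lows : \sum_l ~~ high l + #|high| = 21.
  rewrite -sum_bool -big_split -card_classes -(card_lines plane) -sum1_card.
  by apply: eq_bigr => l _; case: (high l).
have light : \sum_l line_light_count l = 5 * light_count.
  rewrite (eq_bigr _ (fun l _ => line_light_countE l)) light_countE big_distrr /=.
  by rewrite (exchange_flags inc); apply: eq_bigr => c _; rewrite (sum_pencil_const plane).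
by move: size_count_four_le; rewrite big_split -!big_distrr /= light; lia.
Qed.

Theorem class_sizes_eq4 c : n c = 4.
Proof.
have n_le4 x : n x <= 4.
  have := card_high_ge; have := card_high_le; have := card_light_le.
  move=> count_le high_le high_ge.
  have no5 : size_count 5 = 0 by lia.
  have no6 : size_count 6 = 0 by lia.
  have := card0_eq no5 x; have := card0_eq no6 x; rewrite !inE; have := n_le6 x; lia.
apply: (@eq_of_sum_eq _ xpredT n (fun=> 4)) => //.
by rewrite sum_n sum_nat_const card_classes.
Qed.

End ClassWeights.

(** * Arcs in Hjelmslev planes *)

(* A projective Hjelmslev plane whose classes of neighbouring points and lines are affine
   planes over [F]: the lines of the class [l] are numbered by [F * F], its point classes are
   [class_at l j], and the line [m] contains the points [x] of the class [class_at l j]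
   whose label is [parallel j m]. *)
Record hjelmslev_plane (F : finFieldType) := HjelmslevPlane {
  point_class : finType;
  line_class : finType;
  incident : point_class -> line_class -> bool;
  quotient_plane : projective_plane #|F| incident;
  class_at : line_class -> option F -> point_class;
  class_at_inj : forall l, injective (class_at l);
  incidentE : forall c l, incident c l = (c \in codom (class_at l));
  point : finType;
  class_of : point -> point_class;
  label : line_class -> point -> F;
  label_affine : forall x y, class_of x = class_of y ->
    \sum_(l | incident (class_of x) l) (label l x == label l y) = 1 + #|F| * (x == y) }.

(* The lines numbered 0 are the lines of a subplane that meets every class of points once. *)
Definition baer_subplane (F : finFieldType) (H : hjelmslev_plane F) : Prop :=
  exists e : point_class H -> point H, (forall c, class_of (e c) = c) /\
    (forall c l, incident c l -> label l (e c) = 0%R).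

Section Arc.
Variables (F : finFieldType) (H : hjelmslev_plane F).
Hypothesis card_F : #|F| = 4.
Implicit Types (k l : line_class H) (c : point_class H) (x y : point H).
Implicit Types (j : option F) (m : F * F) (s : F).

Definition on_line l m x : bool :=
  [exists j, (class_of x == class_at l j) && (label l x == parallel j m)].

Definition line_count (A : {set point H}) l m : nat := #|[set x in A | on_line l m x]|.

Definition arc (k : nat) (A : {set point H}) : Prop := forall l m, line_count A l m <= k.

Variable A : {set point H}.
Hypothesis arc_A : arc 6 A.

Definition class_count c : nat := #|[pred x in A | class_of x == c]|.
Definition seg_count l c s : nat :=
  #|[pred x in [pred x in A | class_of x == c] | label l x == s]|.
Definition seg_sqr l c : nat := \sum_s seg_count l c s ^ 2.
Local Notation n := class_count.
Local Notation inc := (@incident F H).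
Local Notation w l := (fun j => seg_count l (class_at l j)).

Lemma quotient_plane4 : projective_plane 4 inc.
Proof. by have := quotient_plane H; rewrite card_F. Qed.

Lemma sum_class_count : \sum_c n c = #|A|.
Proof. exact: sum_card_fibre. Qed.

Lemma sum_seg_count l c : \sum_s seg_count l c s = n c.
Proof. exact: sum_card_fibre. Qed.

Lemma perm_line_classes l :
  perm_eq (enum [pred c | inc c l]) [seq class_at l j | j : option F].
Proof.
apply: uniq_perm; first exact: enum_uniq.
  by rewrite map_inj_uniq ?enum_uniq //; apply: class_at_inj.
by move=> c; rewrite mem_enum inE incidentE.
Qed.

Lemma sum_line_classes l (f : point_class H -> nat) :
  \sum_(c | inc c l) f c = \sum_j f (class_at l j).
Proof.
transitivity (\sum_(c <- [seq class_at l j | j : option F]) f c); last by rewrite big_image.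
by rewrite -(perm_big _ (perm_line_classes l)) big_enum; apply: eq_bigl => c; rewrite inE.
Qed.

Lemma row_sum_count l j : row_sum (w l) j = n (class_at l j).
Proof. exact: sum_seg_count. Qed.

Lemma total_count l : total (w l) = weight inc n l.
Proof. by rewrite /weight sum_line_classes; apply: eq_bigr => j _; rewrite row_sum_count. Qed.

Lemma perm_row_sums l : perm_eq (weights inc n l) (row_sums (w l)).
Proof.
rewrite (permPl (perm_map n (perm_line_classes l))) -map_comp.
by rewrite (eq_map (g := row_sum (w l))) // => j; rewrite /= row_sum_count.
Qed.

Lemma line_countE l m : line_count A l m = \sum_(x in A) on_line l m x.
Proof. by rewrite /line_count -sum1dep_card big_mkcondr. Qed.

Lemma on_lineE l m x : on_line l m x =
  \sum_j ((class_of x == class_at l j) && (label l x == parallel j m)) :> nat.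
Proof.
rewrite /on_line; case: existsP => [[j /[dup] xj /andP[/eqP x_class _]]|none]; last first.
  by rewrite big1 // => j _; apply/eqP; rewrite eqb0; apply/negP => xj; case: none; exists j.
rewrite (bigD1 j) //= xj big1 // => k kj; rewrite x_class (inj_eq (@class_at_inj _ H l)).
by rewrite eq_sym (negbTE kj).
Qed.

Lemma line_sum_count l m : line_sum (w l) m = line_count A l m.
Proof.
rewrite line_countE (eq_bigr _ (fun x _ => on_lineE l m x)) exchange_big.
apply: eq_bigr => j _; rewrite /seg_count -sum1_card -big_mkcondr.
by apply: eq_bigl => x; rewrite !inE andbA.
Qed.

Lemma capped_count l : capped (w l) 6.
Proof. by move=> m; rewrite line_sum_count. Qed.

Lemma sum_seg_sqr c : \sum_(l | inc c l) seg_sqr l c = n c ^ 2 + 4 * n c.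
Proof.
under eq_bigr do rewrite /seg_sqr sum_card_fibre_sqr.
rewrite exchange_big /= (eq_bigr (fun=> n c + 4)) => [|x xB].
  by rewrite sum_nat_const -[#|_|]/(n c) mulnDr mulnn [_ * 4]mulnC.
rewrite exchange_big (eq_bigr (fun y => 1 + 4 * (x == y))) => [|y yB]; last first.
  have [/andP[_ /eqP xc] /andP[_ /eqP yc]] := (xB, yB).
  by have := label_affine (etrans xc (esym yc)); rewrite xc card_F.
rewrite big_split sum1_card -big_distrr /= (bigD1 x) //= eqxx big1 // => y /andP[_].
by rewrite eq_sym => /negbTE->.
Qed.

Lemma seg_count_le_support l k c s : inc c l -> inc c k -> l != k ->
  seg_count l c s <= support_size (seg_count k c).
Proof.
move=> cl ck lk; set B := [pred x in [pred x in A | class_of x == c] | label l x == s].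
have label_inj : {in B &, injective (label k)}.
  move=> x y; rewrite !inE => /andP[/andP[_ /eqP xc] /eqP xs] /andP[/andP[_ /eqP yc] /eqP ys] xy.
  apply/eqP/negPn/negP => x_neq_y.
  have := label_affine (etrans xc (esym yc)); rewrite (negbTE x_neq_y) muln0 xc.
  by rewrite (bigD1 l) //= xs ys eqxx (bigD1 k) ?ck 1?eq_sym //= xy eqxx.
rewrite /seg_count -/B -(card_in_image label_inj); apply: subset_leq_card.
apply/subsetP => _ /imageP[x xB ->]; rewrite inE; apply/card_gt0P; exists x.
by move: xB; rewrite !inE => /andP[-> _]; rewrite eqxx.
Qed.

Lemma seg_count_bound l c s : inc c l -> weight inc n l + 4 * seg_count l c s <= 24 + n c.
Proof.
rewrite incidentE => /codomP[j ->]; rewrite -total_count -row_sum_count.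
have := segment_deficit_card4 card_F (@capped_count l) j s; lia.
Qed.

Hypothesis card_A : #|A| = 84.

Lemma sum_class_count84 : \sum_c n c = 84. Proof. by rewrite sum_class_count. Qed.

Definition seg_max l c : nat := \max_s seg_count l c s.

Lemma seg_count_le_max l c s : seg_count l c s <= seg_max l c.
Proof. exact: leq_bigmax. Qed.

Lemma seg_max_bound l c : inc c l -> weight inc n l + 4 * seg_max l c <= 24 + n c.
Proof.
move=> cl; rewrite /seg_max; have [|s ->] := @eq_bigmax _ (seg_count l c); first by rewrite card_F.
exact: seg_count_bound.
Qed.

Lemma sum_seg_max c : 4 * \sum_(l | inc c l) seg_max l c <= 36 + n c.
Proof.
have : \sum_(l | inc c l) (weight inc n l + 4 * seg_max l c) <= \sum_(l | inc c l) (24 + n c).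
  by apply: leq_sum => l; apply: seg_max_bound.
rewrite big_split /= (sum_weight_pencil quotient_plane4 sum_class_count84).
rewrite (sum_pencil_const quotient_plane4) -big_distrr /=.
by lia.
Qed.

Lemma class_count_le6 c : n c <= 6.
Proof.
have : n c ^ 2 + 4 * n c <= \sum_(l | inc c l) seg_max l c * n c.
  rewrite -sum_seg_sqr; apply: leq_sum => l _; rewrite -(sum_seg_count l c) big_distrr /=.
  by apply: leq_sum => s _; rewrite -mulnn leq_mul2r seg_count_le_max orbT.
by rewrite -big_distrl /=; have := sum_seg_max c; move: (\sum_(l | _) _); nia.
Qed.

Lemma class_count_le_max l c : n c <= 4 * seg_max l c.
Proof.
rewrite -(sum_seg_count l c) -[4]card_F -sum_nat_const.
by apply: leq_sum => s _; apply: seg_count_le_max.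
Qed.

Lemma heavy_seg_count_le2 l c s : inc c l -> 4 < n c -> seg_count l c s <= 2.
Proof.
move=> cl n5; have max_ge2 k : 2 <= seg_max k c by have := class_count_le_max k c; lia.
apply: leq_trans (seg_count_le_max l c s) _.
have : \sum_(k | inc c k && (k != l)) 2 <= \sum_(k | inc c k && (k != l)) seg_max k c.
  by apply: leq_sum => k _.
have := sum_pencil_const quotient_plane4 c 2; rewrite (bigD1 l) //=.
have := sum_seg_max c; rewrite (bigD1 l) //=; have := class_count_le6 c.
by move: (\sum_(k | _) 2) (\sum_(k | _) _) => two others; lia.
Qed.

(* The sum of the [seg_sqr] over the five directions leaves no room for a direction meeting
   the class in all four segments. *)
Lemma heavy_support l c : inc c l -> 4 < n c -> support_size (seg_count l c) = 3.
Proof.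
move=> cl n5; have n6 := class_count_le6 c.
have sup_ge3 k : inc c k -> 3 <= support_size (seg_count k c).
  move=> ck; have := sum_le_support (fun s => heavy_seg_count_le2 s ck n5).
  by rewrite sum_seg_count; lia.
have sup_sum : \sum_(k | inc c k) support_size (seg_count k c) = 15.
  have : \sum_(k | inc c k) (seg_sqr k c + 2 * support_size (seg_count k c)) =
      \sum_(k | inc c k) (3 * n c).
    apply: eq_bigr => k ck; rewrite -(sum_seg_count k c).
    exact: sum_sqr_support (fun s => heavy_seg_count_le2 s ck n5).
  rewrite big_split -big_distrr /= sum_seg_sqr (sum_pencil_const quotient_plane4).
  by have [->|->] : n c = 5 \/ n c = 6 by [lia]; lia.
apply/esym; move: l cl; apply: eq_of_sum_eq sup_ge3 _.
by rewrite sup_sum (sum_pencil_const quotient_plane4).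
Qed.

Lemma weight_le_heavy c l : inc c l -> 4 < n c -> weight inc n l <= 16 + n c.
Proof. by move=> cl n5; have := seg_max_bound cl; have := class_count_le_max l c; lia. Qed.

Lemma perm_row_profile l : (forall c, inc c l -> 4 < n c \/ forall s, seg_count l c s <= 1) ->
  forall j, perm_eq (row_values (w l) j) (profile (row_sum (w l) j)).
Proof.
move=> rows j; set c := class_at l j; have cl : inc c l by rewrite incidentE codom_f.
have size_row : size (row_values (w l) j) = 4 by rewrite size_map -cardE card_F.
have <- : sumn (row_values (w l) j) = row_sum (w l) j by exact: sumn_image.
case: (rows c cl) => [n5|le1]; last first.
  by apply: perm_profile_light => //; apply/allP => _ /imageP[s _ ->]; apply: le1.
apply: perm_profile_heavy => //.
- by apply/allP => _ /imageP[s _ ->]; apply: heavy_seg_count_le2.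
- by rewrite count_image sum_bool; apply: heavy_support.
- by rewrite sumn_image; move: n5; rewrite -(sum_seg_count l c).
Qed.

Lemma high_weights l : high inc n l -> has (perm_eq (weights inc n l)) high_types.
Proof.
move=> hl; have rows c : inc c l -> 4 < n c \/ forall s, seg_count l c s <= 1.
  move=> cl; case: (ltnP 4 (n c)) => n4; [by left|right=> s].
  by have := seg_count_bound s cl; move: hl; rewrite /high; lia.
have := row_sums_high_types card_F (@capped_count l) (perm_row_profile rows).
rewrite total_count -/(high inc n l) hl => /(_ (ltnW hl)).
by rewrite (eq_has (permPl (perm_row_sums l))).
Qed.

Lemma no_four_fives l : ~~ perm_eq (weights inc n l) [:: 5; 5; 5; 5; 0].
Proof.
apply/negP => fives; have rows c : inc c l -> 4 < n c \/ forall s, seg_count l c s <= 1.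
  move=> /(mem_weights n); rewrite (perm_mem fives) !inE.
  have [->|_ /eqP nc] := eqVneq (n c) 5; [by left|right=> s].
  have := sum_seg_count l c; rewrite nc => /eqP; rewrite sum_nat_eq0 => /forallP/(_ s)/eqP.
  by move->.
have := row_sums_high_types card_F (@capped_count l) (perm_row_profile rows).
rewrite total_count -sumn_weights (perm_sumn fives) => /(_ isT)/=.
by rewrite -(permPl (perm_row_sums l)) fives.
Qed.

Lemma weight_plus_sqr_le26 l c : inc c l -> n c = 4 -> 3 <= support_size (seg_count l c) ->
  weight inc n l + seg_sqr l c <= 26.
Proof.
move=> cl n4 sup3; have sum4 := sum_seg_count l c; rewrite n4 in sum4.
have le2 s : seg_count l c s <= 2.
  by have := support_le_sum (seg_count l c) s; rewrite sum4; lia.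
have [/forallP le1|/forallPn[s]] := boolP [forall s, seg_count l c s <= 1].
  rewrite /seg_sqr sum_sqr_le1 // sum4.
  by have := weight_le22 high_weights l; lia.
rewrite -ltnNge => s2; have := seg_count_bound s cl; rewrite n4.
by have := sum_sqr_support le2; rewrite sum4 -/(seg_sqr l c); lia.
Qed.

Lemma four_seg_count_neq3 l c s : inc c l -> n c = 4 -> seg_count l c s != 3.
Proof.
move=> cl n4; apply/eqP => w3.
have sqr_l : seg_sqr l c <= 10.
  have rest : \sum_(t | t != s) seg_count l c t = 1.
    by have := sum_seg_count l c; rewrite (bigD1 s) //= w3 n4; lia.
  have rest_le1 t : t != s -> seg_count l c t <= 1.
    by move=> ts; rewrite -rest (bigD1 t) //= leq_addr.
  by rewrite /seg_sqr (bigD1 s) //= w3; have := sum_sqr_le rest_le1; rewrite rest -(leq_add2l 9).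
have : \sum_(k | inc c k) (weight inc n k + seg_sqr k c) <= \sum_(k | inc c k) 26.
  apply: leq_sum => k ck; have [->|kl] := eqVneq k l.
    by have := seg_count_bound s cl; rewrite w3 n4; lia.
  apply: weight_plus_sqr_le26 => //; rewrite -w3.
  by apply: seg_count_le_support => //; rewrite eq_sym.
rewrite big_split /= (sum_weight_pencil quotient_plane4 sum_class_count84) sum_seg_sqr.
by rewrite (sum_pencil_const quotient_plane4) n4.
Qed.

Lemma four_seg_count_neq4 l c s : inc c l -> n c = 4 -> seg_count l c s != 4.
Proof.
move=> cl n4; apply/eqP => w4.
have weight_l : weight inc n l <= 12 by have := seg_count_bound s cl; rewrite w4 n4; lia.
pose sixes k := \sum_(c' | inc c' k) (n c' == 6).
have few_sixes : \sum_(k | inc c k) sixes k <= 3.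
  rewrite (sum_pencil quotient_plane4 c (fun c' => n c' == 6 : nat)) n4 muln0 addn0 sum_bool.
  exact: card_six_le3 high_weights quotient_plane4 sum_class_count84.
have weight_le k : weight inc n k <= 21 + sixes k.
  have sixesE : sixes k = count (pred1 6) (weights inc n k) by rewrite count_image.
  case: (boolP (high inc n k)) => [/(highP high_weights)|]; last by rewrite /high; lia.
  by rewrite sixesE => -[] types; rewrite (permP types).
have := sum_weight_pencil quotient_plane4 sum_class_count84 c; rewrite n4 (bigD1 l) //=.
have : \sum_(k | inc c k && (k != l)) weight inc n k <=
    \sum_(k | inc c k && (k != l)) (21 + sixes k) by apply: leq_sum => k _.
have := sum_pencil_const quotient_plane4 c 21; rewrite big_split (bigD1 l) //=.
by move: few_sixes; rewrite (bigD1 l) //=; move: (\sum_(k | _ && _) _); lia.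
Qed.

Lemma four_seg_count_le2 l c s : inc c l -> n c = 4 -> seg_count l c s <= 2.
Proof.
move=> cl n4; have := four_seg_count_neq3 s cl n4; have := four_seg_count_neq4 s cl n4.
have : seg_count l c s <= 4 by rewrite -n4 -(sum_seg_count l c) (bigD1 s) //= leq_addr.
by move: (seg_count l c s) => [|[|[|[|[]]]]].
Qed.

Lemma four_seg_sqr_bounds l c : inc c l -> n c = 4 -> 4 <= seg_sqr l c <= 8.
Proof.
move=> cl n4; have le2 s := four_seg_count_le2 s cl n4.
have := sum_le_sum_sqr (seg_count l c); rewrite sum_seg_count n4 => ->.
have := sum_sqr_support le2; have := sum_le_support le2.
by rewrite sum_seg_count n4 -/(seg_sqr l c); lia.
Qed.

Definition excess l c : nat := (n c == 4) * (seg_sqr l c - 4).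

Lemma excess_four l c : inc c l -> n c = 4 -> excess l c + 4 = seg_sqr l c.
Proof. by move=> cl n4; have := four_seg_sqr_bounds cl n4; rewrite /excess n4; lia. Qed.

Lemma excess_le4 l c : inc c l -> excess l c <= 4 * (n c == 4).
Proof. by move=> cl; rewrite /excess; case: eqP => // /(four_seg_sqr_bounds cl); lia. Qed.

Lemma excess_high l c : inc c l -> high inc n l -> excess l c = 0.
Proof.
rewrite /high /excess => cl hl; case: eqP => // n4.
have le1 s : seg_count l c s <= 1 by have := seg_count_bound s cl; lia.
by rewrite /seg_sqr sum_sqr_le1 // sum_seg_count n4.
Qed.

Lemma sum_excess_pencil c : n c = 4 -> \sum_(l | inc c l) excess l c = 12.
Proof.
move=> n4; have := sum_seg_sqr c; rewrite n4.
have -> : \sum_(l | inc c l) seg_sqr l c = \sum_(l | inc c l) (excess l c + 4).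
  by apply: eq_bigr => l cl; rewrite excess_four.
by rewrite big_split /= (sum_pencil_const quotient_plane4); lia.
Qed.

Lemma incident_class_at l j : inc (class_at l j) l.
Proof. by rewrite incidentE codom_f. Qed.

Lemma excess_all_fours l : (forall j, n (class_at l j) = 4) ->
  \sum_j excess l (class_at l j) <= 12.
Proof.
move=> n4; have sqr_le : \sum_j row_sqr (w l) j <= 32.
  by apply: (sum_row_sqr_fours_le32 card_F (@capped_count l)) => j; rewrite row_sum_count.
have : \sum_j (excess l (class_at l j) + 4) = \sum_j row_sqr (w l) j.
  by apply: eq_bigr => j _; rewrite excess_four ?incident_class_at.
rewrite big_split /= sum_nat_const card_option card_F.
by move: sqr_le; move: (\sum_j _) (\sum_j _); lia.
Qed.

Lemma excess_fours_and_three l j0 : n (class_at l j0) = 3 ->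
  (forall j, j != j0 -> n (class_at l j) = 4) -> \sum_j excess l (class_at l j) <= 12.
Proof.
move=> n3 n4; have sqr_le : \sum_(j | j != j0) row_sqr (w l) j <= 28.
  apply: (sum_row_sqr_fours_and_three_le28 card_F (@capped_count l)) => j; rewrite row_sum_count.
  by case: eqVneq => [->|/n4].
rewrite (bigD1 j0) //= {1}/excess n3 /= add0n.
have : \sum_(j | j != j0) (excess l (class_at l j) + 4) = \sum_(j | j != j0) row_sqr (w l) j.
  by apply: eq_bigr => j /n4 nj; rewrite excess_four ?incident_class_at.
rewrite big_split /= sum_nat_const cardC1 card_option card_F.
by move: sqr_le; move: (\sum_(j | _) _) (\sum_(j | _) _); lia.
Qed.

Lemma sum_excess_le20 l :
  \sum_j excess l (class_at l j) + 4 * #|[pred j | n (class_at l j) != 4]| <= 20.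
Proof.
rewrite -sum_bool big_distrr -big_split /= -[20]/(5 * 4).
have <- : \sum_(j : option F) 4 = 5 * 4 by rewrite sum_nat_const card_option card_F.
apply: leq_sum => j _; have := excess_le4 (incident_class_at l j).
by case: (_ == 4); rewrite /= ?muln0; lia.
Qed.

Lemma excess_line l :
  \sum_(c | inc c l) excess l c <= 12 * ~~ high inc n l + 4 * line_light_count inc n l.
Proof.
case: (boolP (high inc n l)) => [hl|]; first by rewrite big1 // => c cl; apply: excess_high.
rewrite /high -leqNgt -total_count muln1 sum_line_classes => low.
have excess_le := sum_excess_le20 l.
have [ge2|] := leqP 2 #|[pred j | n (class_at l j) != 4]|; first by lia.
rewrite ltnS leq_eqVlt => /predU1P[/mem_card1[j0 fours]|]; last first.
  rewrite ltnS leqn0 => /eqP/card0_eq fours; apply: leq_trans (leq_addr _ _).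
  by apply: excess_all_fours => j; have := fours j; rewrite !inE => /negbFE/eqP.
have n4 j : j != j0 -> n (class_at l j) = 4.
  by move=> jj0; have := fours j; rewrite !inE (negbTE jj0) => /negbFE/eqP.
have n_le3 : n (class_at l j0) <= 3.
  have := fours j0; rewrite !inE eqxx; move: low; rewrite /total (bigD1 j0) //= row_sum_count.
  rewrite (eq_bigr (fun=> 4)) => [|j /n4 nj]; last by rewrite row_sum_count.
  by rewrite sum_nat_const cardC1 card_option card_F; lia.
have [n3|n_neq3] := eqVneq (n (class_at l j0)) 3.
  by apply: leq_trans (leq_addr _ _); apply: excess_fours_and_three n4.
have : 0 < line_light_count inc n l.
  by apply/card_gt0P; exists (class_at l j0); rewrite inE incident_class_at; lia.
have : #|[pred j | n (class_at l j) != 4]| = 1 by rewrite (eq_card fours) card1.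
by lia.
Qed.

Lemma size_count_four_le : 12 * size_count n 4 <=
  \sum_l (12 * ~~ high inc n l + 4 * line_light_count inc n l).
Proof.
apply: (@leq_trans (\sum_l \sum_(c | inc c l) excess l c)); last first.
  by apply: leq_sum => l _; apply: excess_line.
rewrite (exchange_flags inc (fun c l => excess l c)) size_countE big_distrr.
by apply: leq_sum => c _ /=; case: eqP => [/sum_excess_pencil->|].
Qed.

Theorem class_count_eq4 c : n c = 4.
Proof.
exact: (class_sizes_eq4 high_weights quotient_plane4 sum_class_count84 class_count_le6
          weight_le_heavy no_four_fives size_count_four_le).
Qed.

Theorem line_count_2_or_6 l m : line_count A l m = 2 \/ line_count A l m = 6.
Proof.
have fours k j : row_sum (w k) j = 4 by rewrite row_sum_count class_count_eq4.
have sqr_le k : \sum_j row_sqr (w k) j <= 32.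
  exact: (sum_row_sqr_fours_le32 card_F (@capped_count k) (fours k)).
have sqr_sum : \sum_k \sum_j row_sqr (w k) j = \sum_(k : line_class H) 32.
  rewrite (eq_bigr (fun k => \sum_(c | inc c k) seg_sqr k c)) => [|k _]; last first.
    by rewrite sum_line_classes.
  rewrite (exchange_flags inc (fun c k => seg_sqr k c)).
  under eq_bigr do rewrite sum_seg_sqr class_count_eq4.
  by rewrite -[4 ^ 2 + 4 * 4]/32 !sum_nat_const (card_lines quotient_plane4).
have sqr32 := @eq_of_sum_eq _ xpredT _ (fun=> 32) (fun k _ => sqr_le k) sqr_sum l isT.
by rewrite -line_sum_count; apply: (line_sum_fours card_F (@capped_count l) (fours l)).
Qed.

Lemma on_line0 l x : on_line l (0, 0)%R x = inc (class_of x) l && (label l x == 0%R).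
Proof.
have dir0 j : parallel j (0, 0)%R = 0%R :> F by case: j => [t|] //=; rewrite mulr0 addr0.
rewrite incidentE; apply/existsP/andP => [[j /andP[/eqP-> ]]|[/codomP[j ->] lx]].
  by rewrite dir0 codom_f.
by exists j; rewrite dir0 eqxx.
Qed.

Theorem no_baer_subplane : ~ baer_subplane H.
Proof.
move=> [e [class_e label_e]].
have twos : \sum_l line_count A l (0, 0)%R =
    42 + 4 * #|[pred l | line_count A l (0, 0)%R == 6]|.
  have -> : 42 = \sum_(l : line_class H) 2.
    rewrite sum_nat_const (card_lines quotient_plane4).
    by rewrite (card_classes quotient_plane4 sum_class_count84).
  rewrite -sum_bool big_distrr -big_split; apply: eq_bigr => l _ /=.
  by case: (line_count_2_or_6 l (0, 0)%R) => ->.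
have ones : \sum_l line_count A l (0, 0)%R =
    84 + 4 * #|[pred x in A | x == e (class_of x)]|.
  under eq_bigr do rewrite line_countE.
  rewrite exchange_big -card_A -[#|A|]sum1_card -sum1_card [X in _ * X]big_mkcondr.
  rewrite big_distrr -big_split /=; apply: eq_bigr => x _.
  have := label_affine (esym (class_e (class_of x))); rewrite card_F => <-.
  rewrite [RHS]big_mkcond; apply: eq_bigr => l _; rewrite on_line0.
  by case: (boolP (inc _ l)) => //= xl; rewrite label_e ?class_e.
by move: ones; rewrite twos; lia.
Qed.

End Arc.

Section ArcBounds.
Variables (F : finFieldType) (H : hjelmslev_plane F).
Hypothesis card_F : #|F| = 4.

Lemma sub_arc (k : nat) (A B : {set point H}) : B \subset A -> arc k A -> arc k B.
Proof.
move=> /subsetP sBA arc_A l m; apply: leq_trans (arc_A l m); apply: subset_leq_card.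
by apply/subsetP => x; rewrite !inE => /andP[/sBA-> ->].
Qed.

Theorem arc_card_le84 (A : {set point H}) : arc 6 A -> #|A| <= 84.
Proof.
move=> arc_A; rewrite leqNgt; apply/negP => A_gt84.
have [c n5] : exists c, 4 < class_count A c.
  have [/forallP n_le4|/forallPn[c]] := boolP [forall c, class_count A c <= 4]; last first.
    by rewrite -ltnNge; exists c.
  have : \sum_c class_count A c <= \sum_(c : point_class H) 4 by apply: leq_sum => c _.
  have [x _] : exists x, x \in A by apply/card_gt0P; apply: leq_trans A_gt84.
  rewrite sum_class_count sum_nat_const (card_points (quotient_plane4 H card_F) (class_of x)).
  by rewrite leqNgt A_gt84.
have [|B [_ sB card_B]] := @ex_subset_card _ set0 [set x in A | class_of x == c] 5 (sub0set _).
  by rewrite cards0 cardsE.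
have /subsetP sBA : B \subset A.
  by apply: subset_trans sB _; apply/subsetP => x; rewrite inE => /andP[].
have [|C [sBC sCA card_C]] := @ex_subset_card _ B A 84 (introT subsetP sBA).
  by rewrite card_B (ltnW A_gt84).
have := class_count_eq4 card_F (sub_arc sCA arc_A) card_C c.
have : #|B| <= class_count C c.
  apply: subset_leq_card; apply/subsetP => x xB; rewrite inE (subsetP sBC) //.
  by move/subsetP: sB => /(_ x xB); rewrite inE => /andP[].
by rewrite card_B => + E; rewrite E.
Qed.

Theorem arc_card_lt84 (A : {set point H}) : baer_subplane H -> arc 6 A -> #|A| < 84.
Proof.
move=> sub arc_A; rewrite ltn_neqAle arc_card_le84 // andbT; apply/eqP => card_A.
exact: (no_baer_subplane card_F arc_A card_A sub).
Qed.

End ArcBounds.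

(** * Coordinates *)

Local Open Scope ring_scope.

Section NormalVectors.
Variables (F : finFieldType) (k : nat).
Implicit Types (u v : 'rV[F]_k.+1) (a : F).

Definition pivot v : 'I_k.+1 := odflt ord0 [pick i | v 0 i != 0].
Definition normalised v : bool := v 0 (pivot v) == 1.

Lemma pivotP v : v != 0 -> v 0 (pivot v) != 0.
Proof.
move=> v0; rewrite /pivot; case: pickP => //= none; case/negP: v0; apply/eqP/rowP => i.
by rewrite mxE; apply/eqP/negbFE/none.
Qed.

Lemma pivotZ a v : a != 0 -> pivot (a *: v) = pivot v.
Proof.
move=> a0; congr (odflt _ _); apply: eq_pick => i.
by rewrite mxE mulf_eq0 (negbTE a0).
Qed.

Lemma normalised_neq0 v : normalised v -> v != 0.
Proof. by apply: contraTneq => ->; rewrite /normalised mxE eq_sym oner_eq0. Qed.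

Lemma normalised_scale_inj a u v : normalised u -> normalised v -> u = a *: v -> u = v.
Proof.
move=> u_normal v_normal uv; have a0 : a != 0.
  by apply: contraTneq (normalised_neq0 u_normal) => a0; rewrite uv a0 scale0r eqxx.
move: (eqP u_normal); rewrite {1}uv [pivot u](_ : _ = pivot v); last by rewrite uv pivotZ.
by rewrite mxE (eqP v_normal) mulr1 uv => ->; rewrite scale1r.
Qed.

Definition normalise v := (v 0 (pivot v))^-1 *: v.

Lemma normaliseE v : v != 0 -> v = v 0 (pivot v) *: normalise v.
Proof. by move=> /pivotP vp; rewrite scalerA mulfV ?scale1r. Qed.

Lemma normalise_normalised v : v != 0 -> normalised (normalise v).
Proof.
move=> /pivotP vp; rewrite /normalised /normalise pivotZ ?invr_eq0 //.
by rewrite mxE mulVf.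
Qed.

End NormalVectors.

Section Dot.
Variables (R : nzRingType) (k : nat).
Implicit Types l v : 'rV[R]_k.

Definition dot l v : R := \sum_i l 0 i * v 0 i.

Lemma dotDl l l' v : dot (l + l') v = dot l v + dot l' v.
Proof. by rewrite -big_split; apply: eq_bigr => i _; rewrite mxE mulrDl. Qed.

Lemma dotBr l v v' : dot l (v - v') = dot l v - dot l v'.
Proof. by rewrite /dot -sumrB; apply: eq_bigr => i _; rewrite !mxE mulrBr. Qed.

Lemma dot_eq0 l v : (l *m v^T == 0) = (dot l v == 0).
Proof.
have E : (l *m v^T) 0 0 = dot l v by rewrite mxE; apply: eq_bigr => i _; rewrite mxE.
rewrite -E; apply/eqP/eqP => [->|lv0]; first by rewrite mxE.
by apply/rowP => i; rewrite ord1 lv0 mxE.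
Qed.

End Dot.

Section CommutativeDot.
Variables (R : comNzRingType) (k : nat).
Implicit Types l v : 'rV[R]_k.

Lemma dotC l v : dot l v = dot v l.
Proof. by apply: eq_bigr => i _; rewrite mulrC. Qed.

Lemma dotZr a l v : dot l (a *: v) = a * dot l v.
Proof. by rewrite /dot big_distrr; apply: eq_bigr => i _; rewrite mxE mulrCA. Qed.

End CommutativeDot.

Section ProjectivePlaneOverField.
Variable F : finFieldType.
Implicit Types (u v : 'rV[F]_3) (a : F).

Definition pg : finType := {v : 'rV[F]_3 | normalised v}.
Implicit Types (c l : pg).

Definition orth c l : bool := dot (val l) (val c) == 0.

Lemma orthC c l : orth c l = orth l c. Proof. by rewrite /orth dotC. Qed.

Lemma unique_orth c u : (forall a, u != a *: val c) ->
  (\sum_l (orth c l && (dot (val l) u == 0)%R) = 1)%N.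
Proof.
move=> uc; have c0 := normalised_neq0 (valP c).
pose M := col_mx (val c) u; pose K := kermx M^T.
have kerP v : (v <= K)%MS = (dot v (val c) == 0) && (dot v u == 0).
  by rewrite sub_kermx tr_col_mx mul_mx_row row_mx_eq0 !dot_eq0.
have rankK : \rank K = 1%N.
  rewrite mxrank_ker mxrank_tr; suff -> : \rank M = 2%N by [].
  have cM : (\rank (val c) < \rank M)%N.
    rewrite -addsmxE; apply: rank_ltmx; rewrite /ltmx addsmxSl addsmx_sub submx_refl /=.
    by apply/sub_rVP => -[a ua]; have := uc a; rewrite ua eqxx.
  by apply/eqP; rewrite eqn_leq rank_leq_row; rewrite rank_rV c0 in cM.
have [g gK g0] : exists2 g : 'rV_3, (g <= K)%MS & g != 0.
  by apply/rowV0Pn; rewrite -mxrank_eq0 rankK.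
have Kg v : (v <= K)%MS -> exists a, v = a *: g.
  move=> vK; apply/sub_rVP; apply: submx_trans vK _.
  by rewrite -(mxrank_leqif_sup gK) rankK rank_rV g0.
pose l0 : pg := Sub (normalise g) (normalise_normalised g0).
have l0K : (val l0 <= K)%MS by rewrite SubK scalemx_sub.
rewrite (bigD1 l0) //= big1 => [|l ll0]; first by move: l0K; rewrite kerP => ->.
apply/eqP; rewrite eqb0; apply: contra ll0 => l_orth.
have /Kg[a la] : (val l <= K)%MS by rewrite kerP.
apply/eqP/val_inj/(normalised_scale_inj (a := a * g 0 (pivot g)) (valP l) (valP l0)).
by rewrite SubK scalerA mulfK ?pivotP.
Qed.

End ProjectivePlaneOverField.

Section Solutions.
Variables (R : nzRingType) (p : 'I_3).
Implicit Types (l v : 'rV[R]_3) (a b : R).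

Definition fst_coord v : R := v 0 (lift p 0).
Definition snd_coord v : R := v 0 (lift p 1).

Lemma row3P v v' : v 0 p = v' 0 p -> fst_coord v = fst_coord v' -> snd_coord v = snd_coord v' ->
  v = v'.
Proof.
move=> vp v0 v1; apply/rowP => i; case: (unliftP p i) => [t ->|-> //].
have [-> //|->] // : t = 0 \/ t = 1.
by case: t => [[|[|[]]] ?] //; [left|right]; apply: val_inj.
Qed.

Lemma dot3E l v :
  dot l v = l 0 p * v 0 p + (fst_coord l * fst_coord v + snd_coord l * snd_coord v).
Proof.
rewrite /dot (bigD1_ord p) //= big_ord_recl big_ord1.
by have -> : lift ord0 ord0 = 1 :> 'I_2 by apply: val_inj.
Qed.

Variable l : 'rV[R]_3.
Hypothesis lp : l 0 p = 1.

Definition solution a b : 'rV[R]_3 :=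
  \row_i if unlift p i is Some t then (if t == 0 then a else b)
         else - (fst_coord l * a + snd_coord l * b).

Lemma fst_solution a b : fst_coord (solution a b) = a.
Proof. by rewrite /fst_coord mxE liftK. Qed.

Lemma snd_solution a b : snd_coord (solution a b) = b.
Proof. by rewrite /snd_coord mxE liftK. Qed.

Lemma dot_solution a b : dot l (solution a b) = 0.
Proof. by rewrite dot3E lp mul1r fst_solution snd_solution mxE unlift_none addNr. Qed.

Lemma solutionP v : dot l v = 0 -> v = solution (fst_coord v) (snd_coord v).
Proof.
rewrite dot3E lp mul1r => /eqP; rewrite addr_eq0 => /eqP vp.
by apply: row3P; rewrite ?fst_solution ?snd_solution // mxE unlift_none.
Qed.

Lemma solution_ext v v' : dot l v = 0 -> dot l v' = 0 ->
  fst_coord v = fst_coord v' -> snd_coord v = snd_coord v' -> v = v'.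
Proof. by move=> /solutionP-> /solutionP->; rewrite !fst_solution !snd_solution => -> ->. Qed.

End Solutions.

Section RightScaling.
Variable R : finNzRingType.
Implicit Types (l v : vec R) (r s : R).

Lemma rscaleA v r s : rscale (rscale v r) s = rscale v (r * s).
Proof. by apply/rowP => i; rewrite !mxE mulrA. Qed.

Lemma rscale1 v : rscale v 1 = v.
Proof. by apply/rowP => i; rewrite !mxE mulr1. Qed.

Lemma dot_rscale l v r : dot l (rscale v r) = dot l v * r.
Proof. by rewrite /dot mulr_suml; apply: eq_bigr => i _; rewrite mxE mulrA. Qed.

End RightScaling.

Lemma is_line_orth (R : finNzRingType) (l : 'rV[R]_3) (p : 'I_3) : l 0 p = 1 ->
  is_line [set v : vec R | dot l v == 0].
Proof.
move=> lp; pose sol := solution p l.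
have solD a b : rscale (sol 1 0) a + rscale (sol 0 1) b = sol a b.
  apply: (row3P (p := p)).
  - by rewrite !mxE unlift_none !mulr1 !mulr0 addr0 add0r !mulNr -opprD.
  - by rewrite /fst_coord !mxE liftK /= mul1r mul0r addr0.
  - by rewrite /snd_coord !mxE liftK /= mul1r mul0r add0r.
apply/existsP; exists (sol 1 0); apply/existsP; exists (sol 0 1); apply/andP; split.
  apply/injectiveP => -[a b] [a' b'] /=; rewrite !solD => E.
  have := congr1 (fst_coord p) E; have := congr1 (snd_coord p) E.
  by rewrite /sol !fst_solution !snd_solution => -> ->.
apply/eqP/setP => v; rewrite inE; apply/eqP/imsetP => [/(solutionP lp) ->|[[a b] _ ->]].
  by exists (fst_coord p v, snd_coord p v); rewrite //= solD.
by rewrite /= solD dot_solution.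
Qed.

Section LinesOfPG.
Variable F : finFieldType.
Implicit Types (c l : pg F) (j : option F).
Local Notation fst_at l := (fst_coord (pivot (val l))).
Local Notation snd_at l := (snd_coord (pivot (val l))).

Lemma pg_pivot l : val l 0 (pivot (val l)) = 1.
Proof. exact/eqP/(valP l). Qed.

Definition slope_vec l j : 'rV[F]_3 :=
  solution (pivot (val l)) (val l) (odflt 1 j) (isSome j)%:R.

Lemma slope_vec_neq0 l j : slope_vec l j != 0.
Proof.
apply/eqP => v0; have := congr1 (fst_at l) v0; have := congr1 (snd_at l) v0.
rewrite fst_solution snd_solution /fst_coord /snd_coord !mxE.
by case: j {v0} => [t|] /= /eqP; rewrite ?oner_eq0 // => _ /eqP; rewrite oner_eq0.
Qed.

Definition pg_at l j : pg F :=
  Sub (normalise (slope_vec l j)) (normalise_normalised (slope_vec_neq0 l j)).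

Definition pg_slope l c : option F :=
  if snd_at l (val c) == 0 then None else Some (fst_at l (val c) / snd_at l (val c)).

Definition pg_scale l c : F :=
  if snd_at l (val c) == 0 then fst_at l (val c) else snd_at l (val c).

Lemma pg_atK l : cancel (pg_at l) (pg_slope l).
Proof.
move=> j; rewrite /pg_slope SubK /normalise.
have : (slope_vec l j 0 (pivot (slope_vec l j)))^-1 != 0 by rewrite invr_eq0 pivotP ?slope_vec_neq0.
move: (_^-1) => a a0; rewrite /fst_coord /snd_coord !mxE !liftK.
by case: j => [t|] /=; rewrite ?mulr1 ?mulr0 ?eqxx // (negbTE a0) mulrAC mulfV ?mul1r.
Qed.

Lemma pg_scale_fst l c : pg_scale l c * odflt 1 (pg_slope l c) = fst_at l (val c).
Proof.
by rewrite /pg_scale /pg_slope; case: eqP => [_|/eqP snd0]; rewrite /= ?mulr1 // mulrC divfK.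
Qed.

Lemma pg_scale_snd l c : pg_scale l c * (isSome (pg_slope l c))%:R = snd_at l (val c).
Proof. by rewrite /pg_scale /pg_slope; case: eqP => [->|_]; rewrite /= ?mulr1 ?mulr0. Qed.

Lemma pg_scaleE l c : orth c l -> val c = pg_scale l c *: slope_vec l (pg_slope l c).
Proof.
move=> /eqP cl; apply: (solution_ext (pg_pivot l)) => //.
- by rewrite dotZr (dot_solution (pg_pivot l)) mulr0.
- by rewrite /slope_vec [RHS]mxE [X in _ = _ * X]fst_solution pg_scale_fst.
- by rewrite /slope_vec [RHS]mxE [X in _ = _ * X]snd_solution pg_scale_snd.
Qed.

Lemma pg_slopeK l c : orth c l -> pg_at l (pg_slope l c) = c.
Proof.
move=> cl; apply/esym/val_inj/(normalised_scale_inj (valP c) (valP _)).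
by rewrite [LHS](pg_scaleE cl) {1}(normaliseE (slope_vec_neq0 l _)) scalerA.
Qed.

Lemma orth_codom l c : orth c l = (c \in codom (pg_at l)).
Proof.
apply/idP/codomP => [cl|[j ->]]; first by exists (pg_slope l c); rewrite pg_slopeK.
by rewrite /orth SubK dotZr (dot_solution (pg_pivot l)) mulr0.
Qed.

Lemma pg_scale_neq0 l c : orth c l -> pg_scale l c != 0.
Proof.
move=> cl; apply: contraTneq (normalised_neq0 (valP c)) => a0.
by rewrite (pg_scaleE cl) a0 scale0r eqxx.
Qed.

Lemma card_orth l : (\sum_c orth c l = #|F|.+1)%N.
Proof.
rewrite (eq_bigr (fun c => c \in codom (pg_at l) : nat)) => [|c _]; last by rewrite orth_codom.
by rewrite sum_bool card_codom ?card_option //; apply: can_inj (pg_atK l).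
Qed.

Lemma neq_pg_scale c c' : c != c' -> forall a, val c' != a *: val c.
Proof.
move=> cc' a; apply: contraNneq cc' => c'_a.
by apply/eqP/esym/val_inj/(normalised_scale_inj (valP c') (valP c) c'_a).
Qed.

Lemma projective_plane_orth : projective_plane #|F| (@orth F).
Proof.
have pencils c c' : (\sum_l (orth c l && orth c' l) = 1 + #|F| * (c == c'))%N.
  have [<-|/neq_pg_scale cc'] := eqVneq c c'; last by rewrite muln0 unique_orth.
  by rewrite muln1 add1n -(card_orth c); apply: eq_bigr => l _; rewrite andbb orthC.
split=> // l l'; rewrite -pencils; apply: eq_bigr => c _.
by rewrite (orthC c) (orthC c l').
Qed.

End LinesOfPG.

(** * Chain rings of length two *)

(* A chain ring of length 2 is an extension of its residue field by its radical, a
   one-dimensional vector space on which the right action is twisted by an automorphism. *)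
Record chain_ring2 (F : finFieldType) (R : finNzRingType) := ChainRing2 {
  residue : {rmorphism R -> F};
  residue_rep : F -> R;
  rad_embed : {additive F -> R};
  twist : {rmorphism F -> F};
  residue_repK : cancel residue_rep residue;
  residue_rep0 : residue_rep 0 = 0;
  residue_rep1 : residue_rep 1 = 1;
  rad_embed_inj : injective rad_embed;
  residue_rad : forall b, residue (rad_embed b) = 0;
  residue_eq0 : forall r, residue r = 0 -> exists b, r = rad_embed b;
  mulr_rad : forall r b, r * rad_embed b = rad_embed (residue r * b);
  rad_mulr : forall b r, rad_embed b * r = rad_embed (b * twist (residue r)) }.

Section ChainRing.
Variables (F : finFieldType) (R : finNzRingType) (C : chain_ring2 F R).
Implicit Types (a b : F) (r s : R).
Local Notation res := (residue C).
Local Notation rad := (rad_embed C).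
Local Notation rep := (residue_rep C).
Local Notation tw := (twist C).

Definition rad_coord (r : R) : F := odflt 0 [pick b | rad b == r].

Lemma radK : cancel rad rad_coord.
Proof.
move=> b; rewrite /rad_coord; case: pickP => [b' /eqP/(@rad_embed_inj _ _ C)// | /(_ b)].
by rewrite eqxx.
Qed.

Lemma rad_coordK r : res r = 0 -> rad (rad_coord r) = r.
Proof. by case/(@residue_eq0 _ _ C)=> b ->; rewrite radK. Qed.

Lemma mul_rad_rad a b : rad a * rad b = 0.
Proof. by rewrite mulr_rad residue_rad mul0r raddf0. Qed.

Lemma ex_right_inverse r : res r != 0 -> exists s, r * s = 1.
Proof.
move=> r0; pose s := rep (res r)^-1.
have [b rsE] : exists b, r * s - 1 = rad b.
  by apply: residue_eq0; rewrite rmorphB rmorphM rmorph1 residue_repK divff // subrr.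
exists (s * (1 - rad b)); rewrite mulrA -[r * s](subrK 1) rsE addrC.
by rewrite mulrDl mul1r mulrBr mulr1 mul_rad_rad subr0 subrK.
Qed.

Lemma residue_right_inverse r s : r * s = 1 -> res s != 0.
Proof.
move=> /(congr1 res); rewrite rmorphM rmorph1; apply: contra_eqN => /eqP->.
by rewrite mulr0 eq_sym oner_eq0.
Qed.

Lemma ex_inverse r : res r != 0 -> exists s, r * s = 1 /\ s * r = 1.
Proof.
move=> r0; have [s rs] := ex_right_inverse r0.
have [t st] := ex_right_inverse (residue_right_inverse rs); exists s; split=> //.
by have tr : t = r by [rewrite -[t]mul1r -rs -mulrA st mulr1]; rewrite -tr.
Qed.

Definition residue_vec (v : 'rV[R]_3) : 'rV[F]_3 := map_mx res v.
Definition rep_vec (v : 'rV[F]_3) : 'rV[R]_3 := map_mx rep v.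
Definition rad_vec (v : 'rV[F]_3) : 'rV[R]_3 := map_mx rad v.

Lemma residue_rep_vec (v : 'rV[F]_3) : residue_vec (rep_vec v) = v.
Proof. by apply/rowP => i; rewrite !mxE residue_repK. Qed.

Lemma residue_vec_eq0 (v : 'rV[R]_3) : residue_vec v = 0 -> exists b : 'rV[F]_3, v = rad_vec b.
Proof.
move=> v0; exists (map_mx rad_coord v); apply/rowP => i; rewrite !mxE rad_coordK //.
by move/rowP/(_ i): v0; rewrite !mxE.
Qed.

Lemma residue_dot (l v : 'rV[R]_3) :
  res (dot l v) = dot (residue_vec l) (residue_vec v).
Proof. by rewrite rmorph_sum; apply: eq_bigr => i _; rewrite rmorphM !mxE. Qed.

Lemma dot_rad_vec (l : 'rV[R]_3) (b : 'rV[F]_3) :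
  dot l (rad_vec b) = rad (dot (residue_vec l) b).
Proof. by rewrite raddf_sum; apply: eq_bigr => i _; rewrite !mxE mulr_rad. Qed.

Lemma rad_vec_dot (b : 'rV[F]_3) (v : 'rV[R]_3) :
  dot (rad_vec b) v = rad (dot b (map_mx tw (residue_vec v))).
Proof. by rewrite raddf_sum; apply: eq_bigr => i _; rewrite !mxE rad_mulr. Qed.

Definition normalised_lift (x : 'rV[R]_3) : bool := x 0 (pivot (residue_vec x)) == 1.

Definition phg_point : finType := {x : 'rV[R]_3 | normalised_lift x}.
Implicit Types (x y : phg_point) (c l : pg F).

Lemma residue_normalised x : normalised (residue_vec (val x)).
Proof. by rewrite /normalised {1}/residue_vec mxE (eqP (valP x)) rmorph1. Qed.

Definition residue_class x : pg F := Sub (residue_vec (val x)) (residue_normalised x).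

Definition flag_coord l x : F := rad_coord (dot (rep_vec (val l)) (val x)).

Lemma flag_coordE l x : orth (residue_class x) l ->
  dot (rep_vec (val l)) (val x) = rad (flag_coord l x).
Proof.
by move=> /eqP xl; rewrite rad_coordK // residue_dot residue_rep_vec.
Qed.

Definition phg_label l x : F := - flag_coord l x / tw (pg_scale l (residue_class x)).

Lemma neighbour_sub x y : residue_class x = residue_class y ->
  exists b : 'rV[F]_3, val x - val y = rad_vec b.
Proof.
move=> xy; apply: residue_vec_eq0; have /(congr1 val) := xy; rewrite !SubK /residue_vec map_mxB.
by move=> ->; rewrite subrr.
Qed.

Lemma phg_label_eq x y (b : 'rV[F]_3) l :
  residue_class x = residue_class y -> val x - val y = rad_vec b -> orth (residue_class x) l ->
  (phg_label l x == phg_label l y) = (dot (val l) b == 0).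
Proof.
move=> xy xyE xl; have yl : orth (residue_class y) l by rewrite -xy.
have sig0 : (tw (pg_scale l (residue_class x)))^-1 != 0.
  by rewrite invr_eq0 fmorph_eq0 pg_scale_neq0.
rewrite /phg_label -xy (inj_eq (mulIf sig0)) (inj_eq oppr_inj) -(inj_eq (@rad_embed_inj _ _ C)).
rewrite -!flag_coordE // -subr_eq0 -dotBr xyE dot_rad_vec residue_rep_vec.
by rewrite -(inj_eq (@rad_embed_inj _ _ C) _ 0) raddf0.
Qed.

Lemma pivot_coord x : val x 0 (pivot (val (residue_class x))) = 1.
Proof. exact/eqP/(valP x). Qed.

Lemma phg_label_affine x y : residue_class x = residue_class y ->
  (\sum_(l | orth (residue_class x) l) (phg_label l x == phg_label l y) = 1 + #|F| * (x == y))%N.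
Proof.
move=> xy; rewrite big_mkcond; have [<-|x_neq_y] := eqVneq x y.
  rewrite muln1 add1n -(card_orth (residue_class x)); apply: eq_bigr => l _.
  by rewrite eqxx orthC; case: (orth l _).
have [b xyE] := neighbour_sub xy; rewrite muln0 addn0.
rewrite -[RHS](unique_orth (c := residue_class x) (u := b)).
  by apply: eq_bigr => l _; case: (boolP (orth _ l)) => // xl; rewrite (phg_label_eq xy xyE).
move=> a; apply: contraNneq x_neq_y => b_a; apply/eqP/val_inj/eqP; rewrite -subr_eq0.
suff a0 : a = 0 by rewrite xyE b_a a0 scale0r /rad_vec raddf0.
apply: (@rad_embed_inj _ _ C); rewrite raddf0.
move/rowP: xyE => /(_ (pivot (val (residue_class x)))); rewrite b_a !mxE.
by rewrite pivot_coord xy pivot_coord rmorph1 mulr1 subrr.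
Qed.

(* At a point [x], the form [rep l + rad a] takes the value [rad (flag_coord l x + a . tw x)], so
   slopes have to be read through the twist. *)
Definition twist_slope : option F -> option F := omap (invF (fmorph_inj tw)).

Definition phg_class_at l (j : option F) : pg F := pg_at l (twist_slope j).

Lemma twist_slope_inj : injective twist_slope.
Proof. by move=> [t|] [u|] //= [/(can_inj (f_invF _)) ->]. Qed.

Lemma phg_class_at_inj l : injective (phg_class_at l).
Proof. exact: inj_comp (can_inj (pg_atK l)) twist_slope_inj. Qed.

Lemma orth_phg_class_at c l : orth c l = (c \in codom (phg_class_at l)).
Proof.
rewrite orth_codom; apply/codomP/codomP => -[j ->]; last by exists (twist_slope j).
exists (omap tw j); congr pg_at; case: j => [t|] //=.
by rewrite invF_f.
Qed.

Definition phg : hjelmslev_plane F :=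
  HjelmslevPlane (projective_plane_orth F) phg_class_at_inj orth_phg_class_at phg_label_affine.

Definition offset (p : 'I_3) (m : F * F) : 'rV[F]_3 :=
  \row_i if unlift p i is Some t then (if t == 0 then m.1 else m.2) else 0.

Lemma dot_offset (p : 'I_3) (m : F * F) (v : 'rV[F]_3) :
  dot (offset p m) v = m.1 * fst_coord p v + m.2 * snd_coord p v.
Proof. by rewrite (dot3E p) /fst_coord /snd_coord !mxE unlift_none !liftK mul0r add0r. Qed.

Definition phg_line l (m : F * F) : 'rV[R]_3 :=
  rep_vec (val l) + rad_vec (offset (pivot (val l)) m).

Lemma phg_line_pivot l (m : F * F) : phg_line l m 0 (pivot (val l)) = 1.
Proof. by rewrite !mxE unlift_none raddf0 addr0 pg_pivot residue_rep1. Qed.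

Lemma dot_offset_parallel l c (j : option F) (m : F * F) : pg_slope l c = twist_slope j ->
  dot (offset (pivot (val l)) m) (map_mx tw (val c)) = tw (pg_scale l c) * parallel j m.
Proof.
move=> slope; rewrite dot_offset /fst_coord /snd_coord !mxE -/(fst_coord _ _) -/(snd_coord _ _).
rewrite -pg_scale_fst -pg_scale_snd slope !rmorphM.
case: j {slope} => [t|] /=; last by rewrite rmorph1 rmorph0 !mulr1 !mulr0 addr0 mulrC.
by rewrite (f_invF (fmorph_inj tw)) rmorph1 mulr1; ring.
Qed.

Lemma on_line_dot l (m : F * F) x : on_line (H := phg) l m x -> dot (phg_line l m) (val x) = 0.
Proof.
case/existsP=> j /andP[/eqP x_class /eqP x_label].
have slope : pg_slope l (residue_class x) = twist_slope j.
  by rewrite [residue_class x]x_class pg_atK.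
have xl : orth (residue_class x) l by rewrite orth_phg_class_at; apply/codomP; exists j.
have sig0 : tw (pg_scale l (residue_class x)) != 0 by rewrite fmorph_eq0 pg_scale_neq0.
rewrite dotDl rad_vec_dot flag_coordE // -raddfD (dot_offset_parallel m slope) -x_label.
by rewrite /= /phg_label mulrCA divff // mulr1 subrr raddf0.
Qed.

Definition point_span x : {set vec R} := [set rscale (val x) r | r : R].

Lemma residue_rscale (v : vec R) r :
  residue_vec (rscale v r) = res r *: residue_vec v.
Proof. by apply/rowP => i; rewrite !mxE rmorphM mulrC. Qed.

Lemma point_span_inj : injective point_span.
Proof.
move=> x y xy; have : val y \in point_span x.
  by rewrite xy; apply/imsetP; exists 1; rewrite ?rscale1.
case/imsetP=> r _ yE; apply/val_inj; rewrite yE.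
have res_yE : val (residue_class y) = res r *: val (residue_class x).
  by rewrite !SubK yE residue_rscale.
have res_xy := normalised_scale_inj (valP (residue_class y)) (valP (residue_class x)) res_yE.
suff r1 : r = 1 by rewrite r1 rscale1.
have := pivot_coord y; rewrite res_xy yE mxE pivot_coord mul1r.
by [].
Qed.

Lemma is_point_span (P : {set vec R}) : is_point P -> exists x, P = point_span x.
Proof.
case/existsP=> v /andP[/injectiveP v_inj /eqP ->].
have v0 : residue_vec v != 0.
  apply/eqP => /residue_vec_eq0[b vE]; have : rad 1 = 0.
    apply: v_inj; apply/rowP => i; rewrite vE !mxE mulr0.
    by rewrite mul_rad_rad.
  by rewrite -(raddf0 rad) => /(@rad_embed_inj _ _ C)/eqP; rewrite oner_eq0.
have vp : res (v 0 (pivot (residue_vec v))) != 0 by have := pivotP v0; rewrite mxE.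
have [s [vs sv]] := ex_inverse vp.
have vs_normalised : normalised_lift (rscale v s).
  by rewrite /normalised_lift residue_rscale pivotZ ?(residue_right_inverse vs) // mxE vs.
exists (Sub (rscale v s) vs_normalised); rewrite /point_span SubK; apply/setP => u.
apply/imsetP/imsetP => -[r _ ->].
  by exists (v 0 (pivot (residue_vec v)) * r) => //; rewrite rscaleA mulrA sv mul1r.
by exists (s * r) => //; rewrite rscaleA.
Qed.

Lemma point_span_sub_line l (m : F * F) x : on_line (H := phg) l m x ->
  point_span x \subset [set v : vec R | dot (phg_line l m) v == 0].
Proof.
move=> /on_line_dot xm; apply/subsetP => _ /imsetP[r _ ->]; rewrite inE.
by rewrite dot_rscale xm mul0r.
Qed.

Definition arc_points (A : {set {set vec R}}) : {set point phg} :=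
  [set x : phg_point | point_span x \in A].

Lemma arc_arc_points (n : nat) (A : {set {set vec R}}) :
  is_arc n A -> arc n (arc_points A).
Proof.
move=> /andP[_ /forallP arc_A] l m.
have := arc_A [set v | dot (phg_line l m) v == 0].
rewrite (is_line_orth (phg_line_pivot l m)) /= => le_n; apply: leq_trans le_n.
rewrite /line_count -(card_imset _ point_span_inj); apply: subset_leq_card.
apply/subsetP => _ /imsetP[x + ->].
by rewrite !inE => /andP[-> /point_span_sub_line->].
Qed.

Lemma card_arc_points (n : nat) (A : {set {set vec R}}) :
  is_arc n A -> (#|A| <= #|arc_points A|)%N.
Proof.
move=> /andP[/forallP points _]; rewrite -(card_imset _ point_span_inj); apply: subset_leq_card.
apply/subsetP => Q QA; have := points Q; rewrite QA => /is_point_span[x Qx].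
by apply/imsetP; exists x; rewrite // inE -Qx.
Qed.

Hypothesis card_F : #|F| = 4.

Theorem m_arc_le84 : (m_arc R 6 <= 84)%N.
Proof.
apply/bigmax_leqP => A arc_A; apply: leq_trans (card_arc_points arc_A) _.
exact: (arc_card_le84 card_F (arc_arc_points arc_A)).
Qed.

Hypothesis residue_repD : forall a b, rep (a + b) = rep a + rep b.
Hypothesis residue_repM : forall a b, rep (a * b) = rep a * rep b.

Lemma rep_vec_normalised c : normalised_lift (rep_vec (val c)).
Proof. by rewrite /normalised_lift residue_rep_vec mxE pg_pivot residue_rep1. Qed.

Lemma phg_baer_subplane : baer_subplane phg.
Proof.
exists (fun c => Sub (rep_vec (val c)) (rep_vec_normalised c)); split=> [c|c l cl].
  by apply/val_inj; rewrite !SubK residue_rep_vec.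
rewrite /= /phg_label /flag_coord SubK.
have -> : dot (rep_vec (val l)) (rep_vec (val c)) = rep (dot (val l) (val c)).
  rewrite /dot (big_morph rep residue_repD (residue_rep0 C)); apply: eq_bigr => i _.
  by rewrite !mxE residue_repM.
by rewrite (eqP cl) residue_rep0 -(raddf0 rad) radK oppr0 mul0r.
Qed.

Theorem m_arc_lt84 : (m_arc R 6 < 84)%N.
Proof.
rewrite ltnS; apply/bigmax_leqP => A arc_A; rewrite -ltnS.
apply: leq_ltn_trans (card_arc_points arc_A) _.
exact: (arc_card_lt84 card_F phg_baer_subplane (arc_arc_points arc_A)).
Qed.

End ChainRing.

(** * The rings [G4], [S4] and [T4] *)

Definition F4_inv (x : F4) : F4 :=
  match x with F4_w => F4_w2 | F4_w2 => F4_w | _ => x end.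

Lemma F4_mulVf (x : F4) : x != 0 -> F4_inv x * x = 1.
Proof. by case: x => // /eqP. Qed.

HB.instance Definition _ := GRing.ComNzRing_isField.Build F4 F4_mulVf (erefl _).

Lemma card_F4 : #|{: F4}| = 4.
Proof.
rewrite -(card_codom (can_inj F4_codeK)) -[RHS]card_ord; apply: eq_card => i.
rewrite inE; apply/codomP; exists (F4_decode i); apply: val_inj.
by case: i => [[|[|[|[|//]]]] ?]; rewrite /= inordK.
Qed.

Lemma F4_pchar : 2 \in [pchar F4].
Proof. by rewrite inE /=; apply/eqP. Qed.

Definition S4_rad (b : F4) : S4 := MkS4 0 b.

Fact s4a_is_zmod_morphism : zmod_morphism s4a. Proof. by []. Qed.
Fact s4a_is_monoid_morphism : monoid_morphism s4a. Proof. by []. Qed.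
HB.instance Definition _ := GRing.isZmodMorphism.Build S4 F4 s4a s4a_is_zmod_morphism.
HB.instance Definition _ := GRing.isMonoidMorphism.Build S4 F4 s4a s4a_is_monoid_morphism.
Fact S4_rad_is_zmod_morphism : zmod_morphism S4_rad. Proof. by []. Qed.
HB.instance Definition _ := GRing.isZmodMorphism.Build F4 S4 S4_rad S4_rad_is_zmod_morphism.

Lemma S4_residue_eq0 (r : S4) : s4a r = 0 -> exists b, r = S4_rad b.
Proof. by case: r => a b /= ->; exists b. Qed.

Lemma S4_mulr_rad (r : S4) (b : F4) : r * S4_rad b = S4_rad (s4a r * b).
Proof. by case: r => a c; congr MkS4; rewrite /= mulr0 ?addr0. Qed.

Lemma S4_rad_mulr (b : F4) (r : S4) : S4_rad b * r = S4_rad (b * s4a r).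
Proof. by case: r => a c; congr MkS4; rewrite /= mul0r ?add0r. Qed.

Definition S4_chain : chain_ring2 F4 S4 :=
  @ChainRing2 F4 S4 s4a (fun a => MkS4 a 0) S4_rad idfun (fun _ => erefl) erefl erefl
    (can_inj (f := S4_rad) (g := s4b) (fun _ => erefl)) (fun _ => erefl)
    S4_residue_eq0 S4_mulr_rad S4_rad_mulr.

Lemma S4_repD (a b : F4) : MkS4 (a + b) 0 = MkS4 a 0 + MkS4 b 0.
Proof. by congr MkS4; rewrite /= addr0. Qed.

Lemma S4_repM (a b : F4) : MkS4 (a * b) 0 = MkS4 a 0 * MkS4 b 0.
Proof. by congr MkS4; rewrite /= mulr0 mul0r addr0. Qed.

Definition T4_rad (b : F4) : T4 := MkT4 0 b.

Fact t4a_is_zmod_morphism : zmod_morphism t4a. Proof. by []. Qed.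
Fact t4a_is_monoid_morphism : monoid_morphism t4a. Proof. by []. Qed.
Fact T4_rad_is_zmod_morphism : zmod_morphism T4_rad. Proof. by []. Qed.
HB.instance Definition _ := GRing.isZmodMorphism.Build T4 F4 t4a t4a_is_zmod_morphism.
HB.instance Definition _ := GRing.isMonoidMorphism.Build T4 F4 t4a t4a_is_monoid_morphism.
HB.instance Definition _ := GRing.isZmodMorphism.Build F4 T4 T4_rad T4_rad_is_zmod_morphism.

Lemma T4_residue_eq0 (r : T4) : t4a r = 0 -> exists b, r = T4_rad b.
Proof. by case: r => a b /= ->; exists b. Qed.

Lemma T4_mulr_rad (r : T4) (b : F4) : r * T4_rad b = T4_rad (t4a r * b).
Proof. by case: r => a c; congr MkT4; rewrite /= ?mulr0 ?addr0. Qed.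

Lemma T4_rad_mulr (b : F4) (r : T4) : T4_rad b * r = T4_rad (b * pFrobenius_aut F4_pchar (t4a r)).
Proof. by case: r => a c; congr MkT4; rewrite /= mul0r ?add0r. Qed.

Definition T4_chain : chain_ring2 F4 T4 :=
  @ChainRing2 F4 T4 t4a (fun a => MkT4 a 0) T4_rad (pFrobenius_aut F4_pchar)
    (fun _ => erefl) erefl erefl
    (can_inj (f := T4_rad) (g := t4b) (fun _ => erefl)) (fun _ => erefl)
    T4_residue_eq0 T4_mulr_rad T4_rad_mulr.

Lemma T4_repD (a b : F4) : MkT4 (a + b) 0 = MkT4 a 0 + MkT4 b 0.
Proof. by congr MkT4; rewrite /= addr0. Qed.

Lemma T4_repM (a b : F4) : MkT4 (a * b) 0 = MkT4 a 0 * MkT4 b 0.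
Proof. by congr MkT4; rewrite /= mulr0 mul0r addr0. Qed.

Definition G4_residue (x : G4) : F4 := (val (g4a x))%:R + (val (g4b x))%:R * F4_w.

(* The Teichmueller representatives: [F4_w2] is represented by the root [-1 - w] of
   X^2 + X + 1. *)
Definition G4_rep (a : F4) : G4 :=
  match a with
  | F4_0 => MkG4 0 0 | F4_1 => MkG4 1 0 | F4_w => MkG4 0 1 | F4_w2 => MkG4 (-1) (-1)
  end.

Definition G4_rad (b : F4) : G4 := G4_rep b *+ 2.

Lemma G4_residueD (x y : G4) : G4_residue (x + y) = G4_residue x + G4_residue y.
Proof.
case: x y => [[[|[|[|[|//]]]] ?] [[|[|[|[|//]]]] ?]] [[[|[|[|[|//]]]] ?] [[|[|[|[|//]]]] ?]].
all: by vm_compute.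
Qed.

Lemma G4_residueM (x y : G4) : G4_residue (x * y) = G4_residue x * G4_residue y.
Proof.
case: x y => [[[|[|[|[|//]]]] ?] [[|[|[|[|//]]]] ?]] [[[|[|[|[|//]]]] ?] [[|[|[|[|//]]]] ?]].
all: by vm_compute.
Qed.

Fact G4_residue_is_zmod_morphism : zmod_morphism G4_residue.
Proof.
by move=> x y; apply: (addIr (G4_residue y)); rewrite -G4_residueD !subrK.
Qed.
Fact G4_residue_is_monoid_morphism : monoid_morphism G4_residue.
Proof. by split; last exact: G4_residueM. Qed.
HB.instance Definition _ :=
  GRing.isZmodMorphism.Build G4 F4 G4_residue G4_residue_is_zmod_morphism.
HB.instance Definition _ :=
  GRing.isMonoidMorphism.Build G4 F4 G4_residue G4_residue_is_monoid_morphism.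

Fact G4_rad_is_zmod_morphism : zmod_morphism G4_rad.
Proof. by move=> [] []; apply/eqP; vm_compute. Qed.
HB.instance Definition _ := GRing.isZmodMorphism.Build F4 G4 G4_rad G4_rad_is_zmod_morphism.

Lemma G4_repK : cancel G4_rep G4_residue.
Proof. by case; vm_compute. Qed.

Lemma G4_rad_inj : injective G4_rad.
Proof. by move=> a b /eqP; case: a; case: b; vm_compute. Qed.

Lemma G4_residue_rad (b : F4) : G4_residue (G4_rad b) = 0.
Proof. by case: b; vm_compute. Qed.

Lemma G4_residue_eq0 (r : G4) : G4_residue r = 0 -> exists b, r = G4_rad b.
Proof.
case: r => [[[|[|[|[|//]]]] ?] [[|[|[|[|//]]]] ?]] // _.
1: exists F4_0.
2: exists F4_w.
3: exists F4_1.
4: exists F4_w2.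
all: by apply/eqP; vm_compute.
Qed.

Lemma G4_mulr_rad (r : G4) (b : F4) : r * G4_rad b = G4_rad (G4_residue r * b).
Proof.
by apply/eqP; case: r b => [[[|[|[|[|//]]]] ?] [[|[|[|[|//]]]] ?]] []; vm_compute.
Qed.

Lemma G4_rad_mulr (b : F4) (r : G4) : G4_rad b * r = G4_rad (b * G4_residue r).
Proof. by rewrite mulrC G4_mulr_rad mulrC. Qed.

Definition G4_chain : chain_ring2 F4 G4 :=
  @ChainRing2 F4 G4 G4_residue G4_rep G4_rad idfun G4_repK erefl erefl
    G4_rad_inj G4_residue_rad G4_residue_eq0 G4_mulr_rad G4_rad_mulr.

Theorem theorem4p17 :
  (m_arc G4 6 <= 84)%N /\
  (m_arc S4 6 < 84)%N /\ (m_arc T4 6 < 84)%N.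
Proof.
split; first exact: m_arc_le84 G4_chain card_F4.
split; first exact: (m_arc_lt84 (C := S4_chain) card_F4 S4_repD S4_repM).
exact: (m_arc_lt84 (C := T4_chain) card_F4 T4_repD T4_repM).
Qed.
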